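(* For every countable field $K$ there are valuation domains $R_1$ and $R_2$, both of cardinality $\aleph_1$, both with residue field (isomorphic to) $K$ and with the same value group, such that their quotient fields $Q_1$ and $Q_2$ are generated as $R_1$-, resp. $R_2$-modules by $\aleph_1$ but not by countably many elements, and such that the type $Q_1/R_1$ is essentially uncountable and the type $Q_2/R_2$ is strongly countable.
   Context: A valuation domain is an integral domain whose ideals are linearly ordered by inclusion; its quotient field is denoted $Q$ (with $Q\neq R$). For a valuation domain $R$ of cardinality $\aleph_1$ and an $R$-submodule $J$ of $Q$ with $R\subseteq J$ which is not countably generated, write $J=\bigcup_{\sigma<\omega_1} r_\sigma^{-1}R$ with nonzero $r_\sigma\in R$ such that for $\tau<\sigma$, $r_\tau\mid r_\sigma$ and $r_\sigma\nmid r_\tau$. The type $J/R$ is essentially uncountable if for every $\sigma<\omega_1$ there is $\tau>\sigma$ with $r_\sigma R/r_\tau R$ uncountable; otherwise it is essentially countable. It is strongly countable if $R/r_\sigma R$ is countable for every $\sigma<\omega_1$. These notions are independent of the choice of the $r_\sigma$. *)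

(* Defs.v *)
From HB Require Import structures.
From mathcomp Require Import all_boot all_order all_algebra fraction.
From mathcomp Require Import boolp classical_sets cardinality.
Set Implicit Arguments. Unset Strict Implicit. Unset Printing Implicit Defensive.
Import GRing.Theory.
Local Open Scope ring_scope.
Local Open Scope classical_set_scope.

Notation frac_emb R := (@FracField.tofrac R).

(* [lt] is a strict well-order on A of order type omega_1: A is uncountable
   and every proper initial segment is countable. *)
Record wo_aleph1 (T : Type) (A : set T) (lt : T -> T -> Prop) : Prop := {
  wo_irr : forall x, A x -> ~ lt x x;
  wo_trans : forall x y z, A x -> A y -> A z -> lt x y -> lt y z -> lt x z;
  wo_total : forall x y, A x -> A y -> x = y \/ lt x y \/ lt y x;
  wo_wf : forall B, B `<=` A -> B !=set0 ->
            exists m, B m /\ forall y, B y -> ~ lt y m;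
  wo_uncountable : ~ countable A;
  wo_segments : forall x, A x -> countable [set y | A y /\ lt y x] }.

Definition aleph1 (T : Type) (A : set T) : Prop := exists lt, wo_aleph1 A lt.

Definition dvdR (R : idomainType) (a b : R) : Prop := exists c : R, b = a * c.

Definition ideal (R : idomainType) (I : set R) : Prop :=
  I 0 /\ (forall x y, I x -> I y -> I (x + y)) /\ (forall r x, I x -> I (r * x)).

Definition maximal_ideal (R : idomainType) (I : set R) : Prop :=
  ideal I /\ ~ I 1 /\
  (forall J, ideal J -> I `<=` J -> J = I \/ J 1).

Definition valuation_domain (R : idomainType) : Prop :=
  (forall I J : set R, ideal I -> ideal J -> I `<=` J \/ J `<=` I) /\
  (exists q : {fraction R}, forall r : R, q <> frac_emb R r).

Definition residue_field_iso (R : idomainType) (K : fieldType) : Prop :=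
  exists phi : {rmorphism R -> K},
    (forall k : K, exists r : R, phi r = k) /\
    maximal_ideal [set r : R | phi r = 0].

(* x <=_v y in the value group: y/x in R (x, y in Q). *)
Definition vdiv (R : idomainType) (x y : {fraction R}) : Prop :=
  exists r : R, y = frac_emb R r * x.
Definition vassoc (R : idomainType) (x y : {fraction R}) : Prop :=
  vdiv x y /\ vdiv y x.

(* The value groups Q1^*/U(R1) and Q2^*/U(R2) are isomorphic as ordered
   groups; psi is the isomorphism given on representatives. *)
Definition same_value_group (R1 R2 : idomainType) : Prop :=
  exists psi : {fraction R1} -> {fraction R2},
    (forall x, x != 0 -> psi x != 0) /\
    (forall x y, x != 0 -> y != 0 -> vassoc (psi (x * y)) (psi x * psi y)) /\
    (forall x y, x != 0 -> y != 0 -> (vdiv x y <-> vdiv (psi x) (psi y))) /\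
    (forall z, z != 0 -> exists x, x != 0 /\ vassoc (psi x) z).

Definition generates (R : idomainType) (S : set {fraction R}) : Prop :=
  forall q : {fraction R}, exists n (c : 'I_n -> R) (s : 'I_n -> {fraction R}),
    (forall i, S (s i)) /\ q = \sum_(i < n) frac_emb R (c i) * s i.

Definition mulset (R : idomainType) (a : R) : set R := [set a * x | x in [set: R]].

Definition quot_countable (R : idomainType) (A B : set R) : Prop :=
  exists C : set R, countable C /\ C `<=` A /\
    forall a, A a -> exists2 c, C c & B (a - c).

Definition Q_presentation (R : idomainType) (I : Type) (lt : I -> I -> Prop)
    (r : I -> R) : Prop :=
  wo_aleph1 [set: I] lt /\
  (forall s, r s != 0) /\
  (forall t s, lt t s -> dvdR (r t) (r s) /\ ~ dvdR (r s) (r t)) /\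
  (forall q : {fraction R}, exists s (x : R), q = frac_emb R x / frac_emb R (r s)).

Definition essentially_uncountable (R : idomainType) : Prop :=
  exists (I : Type) (lt : I -> I -> Prop) (r : I -> R),
    Q_presentation lt r /\
    forall s, exists t, lt s t /\ ~ quot_countable (mulset (r s)) (mulset (r t)).

Definition strongly_countable (R : idomainType) : Prop :=
  exists (I : Type) (lt : I -> I -> Prop) (r : I -> R),
    Q_presentation lt r /\
    forall s, quot_countable [set: R] (mulset (r s)).

(* Main.v *)
Require Import Defs.
From HB Require Import structures.
From mathcomp Require Import all_boot all_order all_algebra fraction.
From mathcomp Require Import finmap multiset ring.
From mathcomp Require Import boolp classical_sets cardinality wochoice.
Set Implicit Arguments. Unset Strict Implicit. Unset Printing Implicit Defensive.
Import Order.TTheory GRing.Theory.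
Local Open Scope ring_scope.
Local Open Scope classical_set_scope.

(** Let E be the monoid of finitely supported exponents omega_1 -> nat, ordered
    antilexicographically.  This is a well-order compatible with addition, so
    the full power series ring K[[x_w : w < omega_1]] = K^E is a domain on
    which the least monomial is a valuation; it extends to the fraction field L.
    R2 is the valuation ring of the subfield K(x_w : w < omega_1) of L, and R1
    that of the subfield obtained by adjoining aleph_1 distinct 0/1-series in
    one variable.  Both contain all monomials and K, so they share the value
    group and the residue field K, and the x_w are cofinal in the value group.
    In R2, an element p/q is determined modulo x_w by the terms of p and q whose
    exponents above w agree with those of the least monomial of q; after
    cancelling a monomial these lie in the countable field K(x_v : v <= w).
    In R1, differences of the adjoined series have value below every x_w with w
    large, so they remain distinct in x_u R1 / x_v R1.
    Sizes are controlled by bounding the indices that occur in an expression: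
    each bound allows only countably many expressions. *)

(** * The ordinal omega_1 *)

(** Well-order [T]. If all proper initial segments are countable, [T] itself serves; otherwise the
    segment below the least point with uncountable initial segment does. *)
Lemma wo_aleph1_subset (T : eqType) : ~ countable [set: T] ->
  exists (A : set T) (lt : T -> T -> Prop), wo_aleph1 A lt.
Proof.
move=> ucT; have [R woR] := well_ordering_principle T.
have minR (B : set T) : B !=set0 -> exists2 m, B m & forall y, B y -> R m y.
  move=> [x Bx]; have [|m [[Bm lem] _]] := woR (fun y => `[< B y >]).
    by exists x; apply/asboolP.
  by exists m => [|y By]; [apply/asboolP|apply/lem/asboolP].
(* The order axioms come from least elements of two- and three-element sets. *)
have Rtot x y : R x y || R y x.
  have [|m [->|->] lem] := minR [set x; y]; first by exists x; left.
    by rewrite lem //; right.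
  by rewrite (lem x) ?orbT //; left.
have Ranti x y : R x y -> R y x -> x = y.
  move=> Rxy Ryx; have [|m [_ um]] := woR (pred2 x y).
    by exists x; rewrite inE eqxx.
  rewrite -(um x) ?(um y) //; split=> [|z]; rewrite ?inE ?eqxx ?orbT //;
    move=> /orP[]/eqP-> //.
  - by move: (Rtot y y); rewrite orbb.
  - by move: (Rtot x x); rewrite orbb.
have Rtr x y z : R x y -> R y z -> R x z.
  move=> Rxy Ryz; have [|m [[->|->]|->] lem] := minR [set x; y; z].
  - by exists x; left; left.
  - by apply: lem; right.
  - by rewrite (Ranti x y) //; apply: lem; left; left.
  - have Rzy : R z y by apply: lem; left; right.
    by rewrite -(Ranti y z).
pose lt x y := R x y /\ x <> y.
have ltirr x : ~ lt x x by case.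
have lttr x y z : lt x y -> lt y z -> lt x z.
  move=> [Rxy nxy] [Ryz nyz]; split; first exact: Rtr Ryz.
  by move=> xz; rewrite -xz in Ryz; apply/nxy/Ranti.
have lttot x y : x = y \/ lt x y \/ lt y x.
  have [->|/eqP nxy] := eqVneq x y; first by left.
  by right; case/orP: (Rtot x y) => ?; [left|right]; split=> // /esym.
have ltmin (B : set T) : B !=set0 -> exists m, B m /\ forall y, B y -> ~ lt y m.
  move=> /minR[m Bm lem]; exists m; split=> // y /lem Rmy [Rym].
  by apply; apply: Ranti.
have [sub|] := pselect (forall x, countable [set y | lt y x]).
  exists setT, lt; split=> //.
  - by move=> x y z _ _ _; apply: lttr.
  - by move=> B _; apply: ltmin.
  - by move=> x _; apply: sub_countable (sub x); apply: subset_card_le => y [].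
move=> /existsNP[x0 ncx0].
have [|m [ncm minm]] := ltmin [set x | ~ countable [set y | lt y x]].
  by exists x0.
exists [set y | lt y m], lt; split=> //.
- by move=> x y z _ _ _; apply: lttr.
- by move=> B _; apply: ltmin.
- move=> x xm; have /contrapT cx : ~ ~ countable [set y | lt y x].
    by move=> ncx; apply: minm xm.
  by apply: sub_countable cx; apply: subset_card_le => y [].
Qed.

Lemma uncountable_bitstreams : ~ countable [set: nat -> bool].
Proof.
move=> /countable_injP[f finj].
(* Cantor's diagonal: [d] differs at [n] from the stream coded by [n]. *)
pose d n := ~~ `[< exists2 x, f x = n & x n >].
have := erefl (d (f d)); rewrite {1}/d.
have [[x fx xd]|nex] := asboolP; last first.
  by move=> /esym dd; apply: nex; exists d.
have <- : x = d by apply: finj; rewrite ?in_setT.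
by rewrite fx xd.
Qed.

Definition omega1_spec := cid (wo_aleph1_subset uncountable_bitstreams).
Definition omega1_set : set (nat -> bool) := projT1 omega1_spec.
Definition omega1_rel := projT1 (cid (projT2 omega1_spec)).
Lemma omega1_wo : wo_aleph1 omega1_set omega1_rel.
Proof. exact: projT2 (cid (projT2 omega1_spec)). Qed.

(** Realised inside the bit streams, so that each index is itself a stream; [bit_series] later uses
    these streams as coefficient sequences. *)
Definition omega1 : Type := {x : nat -> bool | `[< omega1_set x >]}.
HB.instance Definition _ := Choice.on omega1.

Definition o1lt (x y : omega1) : bool := `[< omega1_rel (val x) (val y) >].
Definition o1le (x y : omega1) : bool := (x == y) || o1lt x y.

Lemma o1_in (x : omega1) : omega1_set (val x).
Proof. exact/asboolP/(valP x). Qed.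
Lemma o1lt_irr : irreflexive o1lt.
Proof. by move=> x; apply/asboolP/(wo_irr omega1_wo)/o1_in. Qed.
Lemma o1lt_trans : transitive o1lt.
Proof.
move=> y x z /asboolP xy /asboolP yz; apply/asboolP.
exact: (wo_trans omega1_wo (o1_in x) (o1_in y) (o1_in z)).
Qed.
Lemma o1lt_total x y : x != y -> o1lt x y || o1lt y x.
Proof.
move=> /eqP nxy; case: (wo_total omega1_wo (o1_in x) (o1_in y)) => [/val_inj//|].
by case=> h; apply/orP; [left|right]; apply/asboolP.
Qed.
Fact omega1_display : Order.disp_t. Proof. exact: Order.Disp tt tt. Qed.
HB.instance Definition _ := @Order.LtOrder.Build omega1_display omega1
  o1le o1lt _ _ (fun _ _ => erefl) (fun _ _ => erefl) (fun _ _ => erefl)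
  o1lt_irr o1lt_trans o1lt_total.

Lemma omega1_uncountable : ~ countable [set: omega1].
Proof.
move=> /countable_injP[f finj]; apply: (wo_uncountable omega1_wo).
pose g (x : nat -> bool) :=
  if pselect (`[< omega1_set x >]) is left h then f (exist _ x h) else 0%N.
apply/countable_injP; exists g => x y /set_mem Ax /set_mem Ay; rewrite /g.
case: pselect => [hx|[]]; last exact/asboolP.
case: pselect => [hy|[]]; last exact/asboolP.
move=> e.
by have := finj _ _ (in_setT _) (in_setT _) e => -[].
Qed.

Lemma omega1_segment (w : omega1) : countable [set u | (u < w)%O].
Proof.
have /countable_injP[f finj] := wo_segments omega1_wo (o1_in w).
apply/countable_injP; exists (f \o val) => x y /set_mem xw /set_mem yw e.
by apply/val_inj/finj => //; apply/mem_set; split; try exact: o1_in; apply/asboolP.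
Qed.

Lemma omega1_initial (w : omega1) : countable [set u | (u <= w)%O].
Proof.
have -> : [set u | (u <= w)%O] = \bigcup_(b in [set: bool])
    (if b then [set w] else [set u | (u < w)%O]).
  apply/seteqP; split=> u /=; last first.
    by case=> -[] _ /= => [->|/ltW].
  rewrite le_eqVlt => /orP[/eqP->|uw]; first by exists true.
  by exists false.
apply: bigcup_countable => // -[] _; [exact: countable1|exact: omega1_segment].
Qed.

Lemma omega1_min (B : set omega1) : B !=set0 ->
  exists2 m, B m & forall y, B y -> (m <= y)%O.
Proof.
move=> [x Bx]; have [||m [[y By <-] miny]] :=
  wo_wf omega1_wo (B := [set val y | y in B]).
- by move=> _ [y By <-]; exact: o1_in.
- by exists (val x); exists x.
exists y => // z Bz; rewrite leNgt; apply/asboolP/miny.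
by exists z.
Qed.

Lemma omega1_wf : well_founded (fun u w : omega1 => (u < w)%O).
Proof.
move=> w; apply: contrapT => nw.
have [|m nm minm] := omega1_min (B := [set w | ~ Acc (fun u w => (u < w)%O) w]).
  by exists w.
apply: nm; split=> u um; apply: contrapT => /minm; by rewrite leNgt um.
Qed.

(** Otherwise the countable initial segments at the points of [A] would cover [omega1], making it a
    countable union of countable sets. *)
Lemma countable_bounded (A : set omega1) : countable A ->
  exists w, forall u, A u -> (u < w)%O.
Proof.
move=> cA; apply: contrapT => nb; apply: omega1_uncountable.
have -> : [set: omega1] = \bigcup_(u in A) [set v | (v <= u)%O].
  apply/seteqP; split=> // w _; apply: contrapT => nw; apply: nb; exists w => u Au.
  by rewrite ltNge; apply/negP => wu; apply: nw; exists u.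
by apply: bigcup_countable => // u _; exact: omega1_initial.
Qed.

Lemma seq_bounded (s : seq omega1) : exists w, {in s, forall u, (u < w)%O}.
Proof.
apply: (countable_bounded (A := [set` s])).
exact/finite_set_countable/finite_seq.
Qed.

(** An unspecified index, obtained as a bound of the empty list; it need not be the least one. *)
Definition omega1_0 : omega1 := sval (cid (seq_bounded [::])).

(** * Monomials as finite multisets of variables *)

Definition mono : Type := multiset omega1.
HB.instance Definition _ := Choice.on mono.
Definition mono_coef (m : mono) (w : omega1) : nat := (m : multiset omega1) w.
Coercion mono_coef : mono >-> Funclass.

Definition mono0 : mono := mset0.
Definition mono_add (m n : mono) : mono := msetD m n.
Lemma mono_addA : associative mono_add. Proof. exact: msetDA. Qed.
Lemma mono_addC : commutative mono_add. Proof. exact: msetDC. Qed.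
Lemma mono_add0 : left_id mono0 mono_add. Proof. exact: mset0D. Qed.
HB.instance Definition _ := GRing.isNmodule.Build mono mono_addA mono_addC mono_add0.

Definition var (w : omega1) : mono := [mset w]%mset.

Lemma monoP (m n : mono) : (forall w, m w = n w) <-> m = n.
Proof. exact: msetP. Qed.
Lemma mono0E w : (0 : mono) w = 0%N. Proof. exact: mset0E. Qed.
Lemma monoDE (m n : mono) (w : omega1) : (m + n : mono) w = (m w + n w)%N.
Proof. by rewrite [LHS](msetE2 m n w). Qed.
Lemma varE w u : var w u = (u == w).
Proof. by rewrite /var /mono_coef msetnE; case: eqP. Qed.
Lemma mono_addI (m n p : mono) : m + n = m + p -> n = p.
Proof.
move=> /monoP e; apply/monoP => w; have := e w; rewrite !monoDE.
exact: addnI.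
Qed.

Definition mono_filter (P : pred omega1) (m : mono) : mono :=
  seq_mset [seq x <- enum_mset m | P x].
Lemma mono_filterE P m w : mono_filter P m w = if P w then m w else 0%N.
Proof.
rewrite /mono_filter /mono_coef mset_seqE count_filter -(count_mem_mset w m).
case: ifP => Pw; last first.
  by apply/eqP; rewrite -leqn0 leqNgt -has_count; apply/hasPn => x _ /=;
     apply/negP => /andP[/eqP->]; rewrite Pw.
by apply: eq_count => x /=; case: eqP => // ->; rewrite Pw.
Qed.

Lemma mono_ind (P : mono -> Prop) :
  P 0 -> (forall w m, P m -> P (var w + m)) -> forall m, P m.
Proof.
move=> P0 PS m; rewrite -[m]seq_mset_id; elim: (enum_mset m) => [|w s IH].
  suff -> : seq_mset [::] = 0 :> mono by [].
  by apply/monoP => w; rewrite /mono_coef mset_seqE mset0E.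
have -> : seq_mset (w :: s) = var w + seq_mset s :> mono.
  by apply/monoP => u; rewrite monoDE varE /mono_coef !mset_seqE /= eq_sym.
exact: PS.
Qed.

(** Finiteness of the factorizations of a monomial is what makes the product of series a finite sum.
    In a factorization of [var w + m] the variable [w] occurs in one of the two factors; removing it
    there leaves a factorization of [m]. *)
Lemma mono_dec_exists (m : mono) : exists s : seq (mono * mono),
  uniq s /\ forall p, (p \in s) = (p.1 + p.2 == m).
Proof.
suff [s sP] : exists s : seq (mono * mono), forall p, (p \in s) = (p.1 + p.2 == m).
  by exists (undup s); split=> [|p]; rewrite ?undup_uniq ?mem_undup.
elim/mono_ind: m => [|w m [s sP]].
  exists [:: (0, 0)] => -[a b] /=; rewrite inE; apply/eqP/eqP => [[-> ->]|].
    by rewrite addr0.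
  move=> /monoP ab; have [a0 b0] : a = 0 /\ b = 0.
    by split; apply/monoP => w; have /eqP := ab w;
       rewrite monoDE mono0E addn_eq0 => /andP[/eqP ? /eqP ?].
  by rewrite a0 b0.
exists ([seq (var w + p.1, p.2) | p <- s] ++ [seq (p.1, var w + p.2) | p <- s]).
move=> [a b]; rewrite mem_cat /=; apply/orP/eqP.
  case=> /mapP[[c d]]; rewrite sP /= => /eqP <- [-> ->].
    by rewrite addrA.
  by rewrite addrCA.
move=> e.
have pred (c : mono) : (0 < c w)%N -> exists c' : mono, c = var w + c'.
  move=> cw; exists (c `\ w)%mset; apply/esym/msetB1K.
  by rewrite -mset_gt0.
have /monoP/(_ w) := e; rewrite !monoDE varE eqxx.
case: (posnP (mono_coef a w)) => [a0|/pred[a' ea] _]; last first.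
  left; apply/mapP; exists (a', b); rewrite -?ea // sP /=.
  by apply/eqP; apply: (@mono_addI (var w)); rewrite addrA -ea.
case: (posnP (mono_coef b w)) => [b0|/pred[b' eb] _]; first by rewrite a0 b0.
right; apply/mapP; exists (a, b'); rewrite -?eb // sP /=.
by apply/eqP; apply: (@mono_addI (var w)); rewrite addrCA -eb.
Qed.

Definition mono_dec m := sval (cid (mono_dec_exists m)).
Lemma mono_dec_uniq m : uniq (mono_dec m).
Proof. by rewrite /mono_dec; case: cid => s [] /=. Qed.
Lemma mem_mono_dec m p : (p \in mono_dec m) = (p.1 + p.2 == m).
Proof. by rewrite /mono_dec; case: cid => s [] /=. Qed.

(** * The antilexicographic well-order on monomials *)

Lemma seq_max (s : seq omega1) (x : omega1) : x \in s ->
  exists2 w, w \in s & {in s, forall u, (u <= w)%O}.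
Proof.
elim: s x => // y s IH x _; case: s IH => [_|z s IH].
  by exists y; rewrite ?mem_head // => u; rewrite inE => /eqP->.
have [w ws wmax] := IH z (mem_head _ _).
exists (Order.max y w).
  by rewrite maxEle; case: ifP; rewrite ?mem_head // inE ws orbT.
move=> u; rewrite inE le_max => /orP[/eqP->|/wmax->]; rewrite ?lexx ?orbT //.
Qed.

Definition mlt (m n : mono) : bool :=
  `[< exists2 w : omega1, (m w < n w)%N & forall u : omega1, (w < u)%O -> m u = n u >].
Definition mle (m n : mono) : bool := (m == n) || mlt m n.

Lemma mlt_irr : irreflexive mlt.
Proof. by move=> m; apply/asboolP => -[w]; rewrite ltnn. Qed.

Lemma mlt_trans : transitive mlt.
Proof.
move=> n m p /asboolP[w mn emn] /asboolP[v np enp]; apply/asboolP.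
case: (ltgtP w v) => [wv|vw|wv].
- exists v; first by rewrite emn.
  by move=> u vu; rewrite emn ?enp // (lt_trans wv vu).
- exists w; first by rewrite -(enp _ vw).
  by move=> u wu; rewrite emn ?enp // (lt_trans vw wu).
- rewrite -wv in np enp; exists w; first exact: ltn_trans np.
  by move=> u wu; rewrite emn ?enp.
Qed.

(** Distinct monomials differ at finitely many variables, at least one; the largest of these
    decides. *)
Lemma mlt_total (m n : mono) : m != n -> mlt m n || mlt n m.
Proof.
move=> mn.
pose s := [seq w <- enum_mset m ++ enum_mset n | mono_coef m w != mono_coef n w].
have sP (w : omega1) : m w != n w -> w \in s.
  move=> ne; rewrite mem_filter ne mem_cat -!mset_neq0 -negb_and.
  by apply: contra ne => /andP[/eqP hm /eqP hn]; rewrite /mono_coef hm hn.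
have [x mnx] : exists w : omega1, m w != n w.
  apply: contrapT => nx; case/eqP: mn; apply/monoP => w; apply/eqP.
  by apply: contrapT => /negP h; apply: nx; exists w.
have [w ws wmax] := seq_max (sP _ mnx).
have eqw (u : omega1) : (w < u)%O -> m u = n u.
  move=> wu; apply/eqP; apply: contrapT => /negP/sP/wmax.
  by rewrite leNgt wu.
move: ws; rewrite mem_filter neq_ltn => /andP[/orP[h|h] _]; apply/orP.
  by left; apply/asboolP; exists w.
by right; apply/asboolP; exists w => // u /eqw.
Qed.

Fact mono_display : Order.disp_t. Proof. exact: Order.Disp tt tt. Qed.
HB.instance Definition _ := @Order.LtOrder.Build mono_display mono
  mle mlt _ _ (fun _ _ => erefl) (fun _ _ => erefl) (fun _ _ => erefl)
  mlt_irr mlt_trans mlt_total.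

Lemma mltP (m n : mono) : reflect
  (exists2 w : omega1, (m w < n w)%N & forall u : omega1, (w < u)%O -> m u = n u)
  (m < n)%O.
Proof. exact: asboolP. Qed.

Lemma mono_le0 (m : mono) : ((0%R : mono) <= m)%O.
Proof. by rewrite leNgt; apply/mltP => -[w]; rewrite mono0E. Qed.

Lemma mono_ltD2l (p m n : mono) : ((p + m : mono)%R < (p + n : mono)%R)%O = (m < n)%O.
Proof.
apply/mltP/mltP => -[w mn e]; exists w; move: mn; rewrite ?monoDE ?ltn_add2l //.
  by move=> _ u /e; rewrite !monoDE => /addnI.
by move=> _ u /e; rewrite !monoDE => ->.
Qed.

Lemma mono_leD2l (p m n : mono) : ((p + m : mono)%R <= (p + n : mono)%R)%O = (m <= n)%O.
Proof. by rewrite !leNgt mono_ltD2l. Qed.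
Lemma mono_ltD2r (p m n : mono) : ((m + p : mono)%R < (n + p : mono)%R)%O = (m < n)%O.
Proof. by rewrite ![_ + p]addrC mono_ltD2l. Qed.
Lemma mono_leD2r (p m n : mono) : ((m + p : mono)%R <= (n + p : mono)%R)%O = (m <= n)%O.
Proof. by rewrite !leNgt mono_ltD2r. Qed.
Lemma mono_leD (m n p q : mono) : (m <= n)%O -> (p <= q)%O -> ((m + p : mono)%R <= (n + q : mono)%R)%O.
Proof.
move=> mn pq; apply: (@le_trans _ _ ((n + p : mono)%R)); first by rewrite mono_leD2r.
by rewrite mono_leD2l.
Qed.
Lemma mono_ltleD (m n p q : mono) : (m < n)%O -> (p <= q)%O -> ((m + p : mono)%R < (n + q : mono)%R)%O.
Proof.
move=> mn pq; apply: (@lt_le_trans _ _ ((n + p : mono)%R)); first by rewrite mono_ltD2r.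
by rewrite mono_leD2l.
Qed.

(* Induction on a strict bound of the support, then on the exponent of the
   largest variable, then on the remaining monomial. *)
Lemma mlt_wf : well_founded (fun m n : mono => (m < n)%O).
Proof.
suff acc (w : omega1) (m : mono) : (forall u : omega1, (w <= u)%O -> m u = 0%N) ->
    Acc (fun m n : mono => (m < n)%O) m.
  move=> m; have [w wm] := seq_bounded (enum_mset m).
  apply: (acc w) => u wu; apply/eqP; rewrite -leqn0 leqNgt; apply/negP.
  by rewrite /mono_coef mset_gt0 => /wm; rewrite ltNge wu.
elim/(well_founded_induction omega1_wf): w m => w IH m mw.
have [->|m0] := pselect (m = 0).
  by split=> n; rewrite ltNge mono_le0.
have : ((0%R : mono) < m)%O by rewrite lt_neqAle mono_le0 andbT; apply/eqP => /esym.
move=> /mltP[u]; rewrite mono0E => mu above.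
have uw : (u < w)%O by rewrite ltNge; apply/negP => /mw e; rewrite e in mu.
suff gen k (m' : mono) : (forall v : omega1, (u <= v)%O -> m' v = 0%N) ->
    forall n : mono, n u = k -> (forall v : omega1, (u < v)%O -> n v = 0%N) ->
    (forall v : omega1, (v < u)%O -> n v = m' v) -> Acc (fun m n : mono => (m < n)%O) n.
  apply: (gen _ (mono_filter (fun v => (v < u)%O) m)) => //.
  - by move=> v uv; rewrite mono_filterE ltNge uv.
  - by move=> v /above <-; rewrite mono0E.
  - by move=> v vu; rewrite mono_filterE vu.
elim/ltn_ind: k m' => k IHk m' m'u.
have am' := IH u uw m' m'u; elim: am' m'u => {}m' _ IHm' m'u n nu nabove nbelow; split=> p /mltP[x px ex].
pose p' := mono_filter (fun v => (v < u)%O) p.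
have p'u (v : omega1) : (u <= v)%O -> p' v = 0%N.
  by move=> uv; rewrite mono_filterE ltNge uv.
have p'b (v : omega1) : (v < u)%O -> p v = p' v by move=> vu; rewrite mono_filterE vu.
(* The variable [x] decides [p < n]. Below [u] the remainder drops; above [u] is impossible, as [n]
   vanishes there; at [u] the exponent drops and the remainder may be arbitrary. *)
case: (ltgtP x u) => [xu|ux|exu].
- apply: (IHm' p') => //; last 2 first.
  + by rewrite ex.
  + by move=> v uv; rewrite ex ?nabove // (lt_trans xu uv).
  apply/mltP; exists x; first by rewrite -p'b // -nbelow.
  move=> v xv; case: (ltP v u) => [vu|uv]; last by rewrite p'u // m'u.
  by rewrite -p'b // -nbelow // ex.
- by move: px; rewrite nabove.
- rewrite exu in px ex; apply: (IHk (p u) _ p') => //; first by rewrite -nu.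
  by move=> v uv; rewrite ex ?nabove.
Qed.

Lemma mono_min (B : set mono) : B !=set0 ->
  exists2 m, B m & forall n, B n -> (m <= n)%O.
Proof.
move=> [x]; elim/(well_founded_induction mlt_wf): x => x IH Bx.
have [|nex] := pselect (exists2 y, B y & (y < x)%O); first by case=> y By /IH; exact.
by exists x => // y By; rewrite leNgt; apply/negP => yx; apply: nex; exists y.
Qed.

Lemma var_lt (w v : omega1) : (var w < var v)%O = (w < v)%O.
Proof.
have lt (a b : omega1) : (a < b)%O -> (var a < var b)%O.
  move=> ab; apply/mltP; exists b; first by rewrite !varE eqxx gt_eqF.
  by move=> u bu; rewrite !varE !gt_eqF // (lt_trans ab bu).
case: (ltgtP w v) => [/lt//|/lt/ltW|->]; last by rewrite ltxx.
by rewrite leNgt => /negbTE.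
Qed.

Lemma var_inj : injective var.
Proof.
by move=> w v e; apply/eqP; rewrite eq_le !leNgt -!var_lt e ltxx.
Qed.

Lemma lt_var (m : mono) (v : omega1) :
  (forall u : omega1, (v <= u)%O -> m u = 0%N) -> (m < var v)%O.
Proof.
move=> mv; apply/mltP; exists v; first by rewrite mv // varE eqxx.
by move=> u vu; rewrite mv ?ltW // varE gt_eqF.
Qed.

(** Any variable beyond the support dominates [m], so the variables are cofinal among the
    monomials. *)
Lemma mono_bounded (m : mono) : exists w, (m < var w)%O.
Proof.
have [w wm] := seq_bounded (enum_mset m); exists w; apply: lt_var => u wu.
apply/eqP; rewrite -leqn0 leqNgt; apply/negP.
by rewrite /mono_coef mset_gt0 => /wm; rewrite ltNge wu.
Qed.

(** * Power series *)

Section ClassicalUnits.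
Variable T : comNzRingType.
(** Invertibility is decided by excluded middle and a non-unit is its own inverse, as the unit ring
    interface prescribes. Used for the power series and for the valuation rings. *)
Definition classical_unit : {pred T} := fun x => `[< exists y, y * x = 1 >].
Definition classical_inv (x : T) : T :=
  if pselect (exists y, y * x = 1) is left h then sval (cid h) else x.
Lemma classical_mulVx : {in classical_unit, left_inverse 1 classical_inv *%R}.
Proof.
move=> x /asboolP ex; rewrite /classical_inv; case: pselect => // h.
by case: (cid h).
Qed.
Lemma classical_unitPl (x y : T) : y * x = 1 -> classical_unit x.
Proof. by move=> yx; apply/asboolP; exists y. Qed.
Lemma classical_inv_out : {in [predC classical_unit], classical_inv =1 id}.
Proof.
by move=> x /asboolPn nx; rewrite /classical_inv; case: pselect.
Qed.
End ClassicalUnits.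

(** Supports are arbitrary: products are finite sums since a monomial has finitely many
    factorizations, and a nonzero series has a least monomial since the monomials are
    well-ordered. *)
Definition pseries (K : fieldType) : Type := mono -> K.

Section PowerSeries.
Variable K : fieldType.
Implicit Types (p q r : pseries K) (m n : mono).

Definition coef p m : K := p m.

Lemma pseriesP p q : (forall m, coef p m = coef q m) <-> p = q.
Proof. by split=> [e|-> //]; apply/funext => m; exact: e. Qed.

HB.instance Definition _ := gen_eqMixin (pseries K).
HB.instance Definition _ := gen_choiceMixin (pseries K).

Definition ps0 : pseries K := fun=> 0.
Definition ps_opp p : pseries K := fun m => - p m.
Definition ps_add p q : pseries K := fun m => p m + q m.
Lemma ps_addA : associative ps_add.
Proof. by move=> p q r; apply/funext => m; rewrite /ps_add addrA. Qed.
Lemma ps_addC : commutative ps_add.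
Proof. by move=> p q; apply/funext => m; rewrite /ps_add addrC. Qed.
Lemma ps_add0 : left_id ps0 ps_add.
Proof. by move=> p; apply/funext => m; rewrite /ps_add add0r. Qed.
Lemma ps_addN : left_inverse ps0 ps_opp ps_add.
Proof. by move=> p; apply/funext => m; rewrite /ps_add addNr. Qed.
HB.instance Definition _ :=
  GRing.isZmodule.Build (pseries K) ps_addA ps_addC ps_add0 ps_addN.

Definition ps_mul p q : pseries K :=
  fun m => \sum_(d <- mono_dec m) coef p d.1 * coef q d.2.
Definition ps_mono (c : K) m : pseries K := fun n => if n == m then c else 0.

Lemma ps_mulC : commutative ps_mul.
Proof.
move=> p q; apply/funext => m; rewrite /ps_mul.
pose sw (d : mono * mono) := (d.2, d.1).
have swK : involutive sw by case.
rewrite (perm_big (map sw (mono_dec m))) /=; last first.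
  apply: uniq_perm; rewrite ?map_inj_uniq ?mono_dec_uniq //; first exact: inv_inj.
  by move=> d; rewrite -[d]swK (mem_map (inv_inj swK)) !mem_mono_dec /= addrC.
by rewrite big_map; apply: eq_bigr => d _; rewrite mulrC.
Qed.

(** Both sides sum over the triples of monomials with total [m]; the two nested enumerations are
    duplicate-free lists of the same triples. *)
Lemma ps_mulA : associative ps_mul.
Proof.
move=> p q r; apply/funext => m; rewrite /ps_mul /coef.
pose F (t : mono * mono * mono) := p t.1.1 * q t.1.2 * r t.2.
transitivity (\sum_(t <- [seq (d.1, e.1, e.2) | d <- mono_dec m, e <- mono_dec d.2]) F t).
  rewrite big_allpairs_dep; apply: eq_bigr => d _.
  by rewrite big_distrr; apply: eq_bigr => e _; rewrite /F /= mulrA.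
transitivity (\sum_(t <- [seq (e.1, e.2, d.2) | d <- mono_dec m, e <- mono_dec d.1]) F t).
  apply: perm_big; apply: uniq_perm.
  - apply: allpairs_uniq_dep => [|d _|]; rewrite ?mono_dec_uniq //.
    move=> x y /allpairsPdep[[a b] [[c d] [_ cd ->]]].
    move=> /allpairsPdep[[a' b'] [[c' d'] [_ cd' ->]]] /=.
    move: cd cd'; rewrite !mem_mono_dec /= => /eqP <- /eqP <- [-> -> ->] //.
  - apply: allpairs_uniq_dep => [|d _|]; rewrite ?mono_dec_uniq //.
    move=> x y /allpairsPdep[[a b] [[c d] [_ cd ->]]].
    move=> /allpairsPdep[[a' b'] [[c' d'] [_ cd' ->]]] /=.
    move: cd cd'; rewrite !mem_mono_dec /= => /eqP <- /eqP <- [-> -> ->] //.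
  move=> [[a b] c]; apply/allpairsPdep/allpairsPdep => -[x [y []]];
    rewrite !mem_mono_dec => /eqP xm /eqP yx [-> -> ->].
    exists (x.1 + y.1, y.2), (x.1, y.1); rewrite !mem_mono_dec /= eqxx.
    by rewrite -addrA yx xm eqxx.
  exists (y.1, y.2 + x.2), (y.2, x.2); rewrite !mem_mono_dec /= eqxx.
  by rewrite addrA yx xm eqxx.
rewrite big_allpairs_dep; apply: eq_bigr => d _.
by rewrite big_distrl; apply: eq_bigr => e _.
Qed.

Lemma ps_mul1 : left_id (ps_mono 1 0) ps_mul.
Proof.
move=> p; apply/funext => m; rewrite /ps_mul (bigD1_seq (0, m)) /=; last 2 first.
- by rewrite mem_mono_dec /= add0r.
- exact: mono_dec_uniq.
rewrite {1}/coef /ps_mono eqxx mul1r big1_seq ?addr0 // => -[a b] /andP[ab].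
rewrite mem_mono_dec /coef /= => /eqP abm.
case: eqP => [a0|]; last by rewrite mul0r.
by rewrite a0 add0r in abm; rewrite a0 abm eqxx in ab.
Qed.

Lemma ps_mulDl : left_distributive ps_mul ps_add.
Proof.
move=> p q r; apply/funext => m; rewrite /ps_mul /ps_add -big_split /=.
by apply: eq_bigr => d _; rewrite /coef mulrDl.
Qed.

Lemma ps_1neq0 : ps_mono 1 0 != 0 :> pseries K.
Proof.
apply/eqP => /pseriesP/(_ 0); rewrite /coef /ps_mono eqxx => /eqP.
by rewrite oner_eq0.
Qed.

HB.instance Definition _ := GRing.Zmodule_isComNzRing.Build (pseries K)
  ps_mulA ps_mulC ps_mul1 ps_mulDl ps_1neq0.

Lemma coef_add p q m : coef (p + q) m = coef p m + coef q m. Proof. by []. Qed.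
Lemma coef_opp p m : coef (- p) m = - coef p m. Proof. by []. Qed.
Lemma coef_zero m : coef 0 m = 0. Proof. by []. Qed.
Lemma coef_mul p q m :
  coef (p * q) m = \sum_(d <- mono_dec m) coef p d.1 * coef q d.2.
Proof. by []. Qed.
Lemma coef_mono c m n : coef (ps_mono c m) n = if n == m then c else 0.
Proof. by []. Qed.
Lemma ps_mono1 : ps_mono 1 0 = 1. Proof. by []. Qed.

(* [vge m p]: the valuation of [p] is at least [m]. *)
Definition vge m p := forall n, (n < m)%O -> coef p n = 0.

(** Addition is strictly monotone, so a pair other than [(m, n)] with sum at most [m + n] has a
    component below its bound, where the coefficient vanishes. *)
Lemma vge_dec m n p q (d : mono * mono) : vge m p -> vge n q ->
  ((d.1 + d.2 : mono)%R <= (m + n : mono)%R)%O -> d != (m, n) -> coef p d.1 * coef q d.2 = 0.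
Proof.
case: d => a b /= pm qn ab neq.
case: (ltP a m) => [/pm ->|ma]; first by rewrite mul0r.
case: (ltP b n) => [/qn ->|nb]; first by rewrite mulr0.
move: ma; rewrite le_eqVlt => /orP[/eqP e|ma]; last first.
  by have := le_lt_trans ab (mono_ltleD ma nb); rewrite ltxx.
move: ab; rewrite e mono_leD2l => bn; case/eqP: neq; congr (_, _).
  by rewrite e.
by apply/eqP; rewrite eq_le nb bn.
Qed.

(** Only the pair [(m, n)] survives in the convolution. The bounds need not be attained, so the
    residue computations can use this even when a coefficient is zero. *)
Lemma coefM_lead m n p q : vge m p -> vge n q ->
  coef (p * q) (m + n) = coef p m * coef q n.
Proof.
move=> pm qn; rewrite coef_mul (bigD1_seq (m, n)) ?mono_dec_uniq //=; last first.
  by rewrite mem_mono_dec.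
rewrite big1_seq ?addr0 // => d /andP[dn]; rewrite mem_mono_dec => /eqP e.
by apply: (vge_dec pm qn) => //; rewrite e.
Qed.

Lemma vgeM m n p q : vge m p -> vge n q -> vge (m + n) (p * q).
Proof.
move=> pm qn x xmn; rewrite coef_mul big1_seq // => d.
rewrite mem_mono_dec => /eqP e; apply: (vge_dec pm qn); first by rewrite e ltW.
by apply: contraTneq xmn => dmn; rewrite -e dmn ltxx.
Qed.

Lemma vgeD m p q : vge m p -> vge m q -> vge m (p + q).
Proof. by move=> pm qm x xm; rewrite coef_add pm // qm // addr0. Qed.
Lemma vgeN m p : vge m p -> vge m (- p).
Proof. by move=> pm x xm; rewrite coef_opp pm // oppr0. Qed.
Lemma vge_le m n p : (m <= n)%O -> vge n p -> vge m p.
Proof. by move=> mn pn x xm; apply: pn; exact: lt_le_trans mn. Qed.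
Lemma vge0 p : vge 0 p.
Proof. by move=> x; rewrite ltNge mono_le0. Qed.
Lemma vge_mono c m : vge m (ps_mono c m).
Proof. by move=> x xm; rewrite coef_mono lt_eqF. Qed.

(* Opaque, so that unification never unfolds it; the value at 0 is junk. *)
Lemma lead_spec : {f : pseries K -> mono | forall p, p != 0 -> vge (f p) p /\ coef p (f p) != 0}.
Proof.
suff /choice[f fP] p : exists m, p != 0 -> vge m p /\ coef p m != 0 by exists f.
have [->|p0] := eqVneq p 0; first by exists 0.
have [|m pm minm] := mono_min (B := [set m | coef p m != 0]).
  apply: contrapT => np; case/eqP: p0; apply/pseriesP => m; apply/eqP.
  by apply: contrapT => /negP h; apply: np; exists m.
exists m => _; split=> // x xm; apply/eqP; apply: contrapT => /negP/minm.
by rewrite leNgt xm.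
Qed.
Definition lead := sval lead_spec.

Lemma vge_lead p : vge (lead p) p.
Proof. by have [->//|/(svalP lead_spec)[]] := eqVneq p 0. Qed.
Lemma coef_lead p : p != 0 -> coef p (lead p) != 0.
Proof. by move=> /(svalP lead_spec)[]. Qed.

Lemma coef_neq0 p m : coef p m != 0 -> p != 0.
Proof. by apply: contraNneq => ->; rewrite coef_zero. Qed.

Lemma vge_le_lead m p : p != 0 -> vge m p -> (m <= lead p)%O.
Proof.
move=> /coef_lead p0 pm; rewrite leNgt; apply/negP => /pm e.
by rewrite e eqxx in p0.
Qed.
Lemma lead_eq m p : vge m p -> coef p m != 0 -> lead p = m.
Proof.
move=> pm cm; apply/eqP; rewrite eq_le (vge_le_lead (coef_neq0 cm) pm) andbT.
by rewrite leNgt; apply/negP => /(@vge_lead p) e; rewrite e eqxx in cm.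
Qed.

Lemma ps_integral : GRing.integral_domain_axiom (pseries K).
Proof.
move=> p q pq0; have [//|p0] := eqVneq p 0; have [//|q0] := eqVneq q 0.
have := coefM_lead (@vge_lead p) (@vge_lead q); rewrite pq0 coef_zero => /esym/eqP.
by rewrite mulf_eq0 (negbTE (coef_lead p0)) (negbTE (coef_lead q0)).
Qed.

HB.instance Definition _ := GRing.ComNzRing_hasMulInverse.Build (pseries K)
  (@classical_mulVx (pseries K)) (@classical_unitPl (pseries K))
  (@classical_inv_out (pseries K)).
HB.instance Definition _ := GRing.ComUnitRing_isIntegral.Build (pseries K) ps_integral.

Lemma leadM p q : p != 0 -> q != 0 -> lead (p * q) = lead p + lead q.
Proof.
move=> p0 q0; apply: lead_eq; first exact: vgeM (@vge_lead p) (@vge_lead q).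
by rewrite coefM_lead; try exact: vge_lead; rewrite mulf_neq0 ?coef_lead.
Qed.

Lemma ps_mono_neq0 c m : c != 0 -> ps_mono c m != 0 :> pseries K.
Proof. by move=> c0; apply: (@coef_neq0 _ m); rewrite coef_mono eqxx. Qed.
Lemma lead_mono c m : c != 0 -> lead (ps_mono c m) = m.
Proof. by move=> c0; apply: lead_eq; [exact: vge_mono|rewrite coef_mono eqxx]. Qed.
Lemma ps_monoM (b c : K) m n : ps_mono b m * ps_mono c n = ps_mono (b * c) (m + n).
Proof.
apply/pseriesP => x; rewrite coef_mul coef_mono; case: eqP => [->|xmn].
  rewrite -coef_mul coefM_lead; try exact: vge_mono.
  by rewrite !coef_mono !eqxx.
rewrite big1_seq // => d; rewrite mem_mono_dec !coef_mono => /eqP e.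
case: eqP => [d1|]; last by rewrite mul0r.
case: eqP => [d2|]; last by rewrite mulr0.
by case: xmn; rewrite -e d1 d2.
Qed.
End PowerSeries.

(** * The valuation on fractions of power series *)

Local Notation "x %:F" := (@FracField.tofrac _ x).

Section Fractions.
Variable R : idomainType.
Implicit Types (a b c d : R) (x y : {fraction R}).
Local Open Scope quotient_scope.

Lemma fraction_repr x : {ab : R * R | ab.2 != 0 & x = ab.1%:F / ab.2%:F}.
Proof.
exists (\n_(repr x), \d_(repr x)); rewrite /= ?denom_ratioP //.
apply: (canRL (mulfK _)); first by rewrite tofrac_eq0 denom_ratioP.
(* The claim becomes an equivalence of two ratios, checked by cross-multiplication. *)
rewrite -{1}[x]reprK; case: (repr x) => [[n d] /= nd].
unlock FracField.tofrac; rewrite -[LHS]FracField.pi_mul; apply/eqmodP.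
rewrite /= FracField.equivfE /FracField.mulf !numden_Ratio ?oner_eq0 ?mulr1 //.
by rewrite mulrC.
Qed.

(** One chosen representation, not a reduced one. Notions defined through it come with a lemma of
    independence of the choice: [vint_frac], [residue_frac], [fval_frac]. *)
Definition fnum x : R := (s2val (fraction_repr x)).1.
Definition fden x : R := (s2val (fraction_repr x)).2.

Lemma fden_neq0 x : fden x != 0.
Proof. exact: (s2valP (fraction_repr x)). Qed.
Lemma fnumden x : x = (fnum x)%:F / (fden x)%:F.
Proof. exact: (s2valP' (fraction_repr x)). Qed.

Lemma frac_eq a b c d : b != 0 -> d != 0 ->
  (a%:F / b%:F == c%:F / d%:F) = (a * d == c * b).
Proof. by move=> b0 d0; rewrite eqr_div ?tofrac_eq0 // -!tofracM tofrac_eq. Qed.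
End Fractions.

Section ValuationOfFractions.
Variable K : fieldType.
Local Notation L := {fraction (pseries K)}.
Implicit Types (p q : pseries K) (x y : L) (m : mono).

(** The valuation ring of [L]. Phrasing it with [vge] instead of [lead] of the numerator makes zero
    integral, whose [lead] is junk. *)
Definition vint x := vge (lead (fden x)) (fnum x).

(** Equal cross products of nonzero series have equal leading monomials, so
    [lead p1 + lead q2 = lead p2 + lead q1]; a denominator exceeding its numerator in one
    representation would do so in the other. *)
Lemma vint_frac p q : q != 0 -> vint (p%:F / q%:F) <-> vge (lead q) p.
Proof.
have half p1 q1 p2 q2 : q1 != 0 -> q2 != 0 -> p1 * q2 = p2 * q1 ->
    vge (lead q1) p1 -> vge (lead q2) p2.
  move=> q10 q20 e v1; have [->//|p20] := eqVneq p2 0.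
  have p10 : p1 != 0.
    by apply: contra_neq p20 => p10; apply/eqP; move/esym/eqP: e;
       rewrite p10 mul0r mulf_eq0 (negbTE q10) orbF.
  apply: vge_le (@vge_lead _ p2); rewrite leNgt; apply/negP => lt2.
  have := congr1 (@lead K) e; rewrite !leadM // => el.
  have := mono_ltleD lt2 (vge_le_lead p10 v1).
  by rewrite -el addrC ltxx.
move=> q0; set x := p%:F / _.
have /eqP : p%:F / q%:F = (fnum x)%:F / (fden x)%:F by rewrite -fnumden.
rewrite frac_eq ?fden_neq0 // => /eqP e; split; apply: half => //; exact: fden_neq0.
Qed.

Lemma vint_ps p : vint p%:F.
Proof.
rewrite -[p%:F]divr1; apply/(@vint_frac p 1); first exact: oner_neq0.
by rewrite -ps_mono1 lead_mono ?oner_neq0 //; exact: vge0.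
Qed.

Lemma frac_sub p q p' q' : q != 0 -> q' != 0 ->
  p%:F / q%:F - p'%:F / q'%:F = (p * q' - p' * q)%:F / (q * q')%:F.
Proof.
move=> q0 q'0; rewrite -mulNr addf_div ?tofrac_eq0 // mulNr -!tofracM.
by rewrite -tofracB.
Qed.
Lemma frac_mul p q p' q' :
  p%:F / q%:F * (p'%:F / q'%:F) = (p * p')%:F / (q * q')%:F.
Proof. by rewrite mulf_div -!tofracM. Qed.

Lemma vge_cross p q p' q' : q != 0 -> q' != 0 -> vge (lead q) p -> vge (lead q') p' ->
  vge (lead (q * q')) (p * q') /\ vge (lead (q * q')) (p' * q).
Proof.
move=> q0 q'0 v v'; rewrite leadM //; split; first exact: vgeM v (@vge_lead _ q').
by rewrite mulrC; exact: vgeM (@vge_lead _ q) v'.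
Qed.

Lemma vintB x y : vint x -> vint y -> vint (x - y).
Proof.
move=> ix iy; rewrite [x]fnumden [y]fnumden frac_sub ?fden_neq0 //.
apply/vint_frac; first by rewrite mulf_neq0 ?fden_neq0.
have [v v'] := vge_cross (fden_neq0 x) (fden_neq0 y) ix iy.
by apply: vgeD => //; apply: vgeN.
Qed.
Lemma vintM x y : vint x -> vint y -> vint (x * y).
Proof.
move=> ix iy; rewrite [x]fnumden [y]fnumden frac_mul.
apply/vint_frac; first by rewrite mulf_neq0 ?fden_neq0.
by rewrite leadM ?fden_neq0 //; exact: vgeM.
Qed.
Lemma vint1 : vint 1. Proof. by rewrite -tofrac1; exact: vint_ps. Qed.
Lemma vint0 : vint 0. Proof. by rewrite -tofrac0; exact: vint_ps. Qed.

Lemma fnum_neq0 x : x != 0 -> fnum x != 0.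
Proof.
apply: contra_neq => e; by rewrite [x]fnumden e tofrac0 mul0r.
Qed.

Lemma vint_total x : vint x \/ vint x^-1.
Proof.
have [->|x0] := eqVneq x 0; first by left; exact: vint0.
have n0 := fnum_neq0 x0.
case: (leP (lead (fden x)) (lead (fnum x))) => h; [left|right].
  exact: vge_le h (@vge_lead _ _).
rewrite [x]fnumden invf_div; apply/vint_frac => //.
exact: vge_le (ltW h) (@vge_lead _ _).
Qed.

(** For integral [x] this is the quotient of the leading coefficients when [x] is a unit, and zero
    when its value is positive. Elsewhere it carries no meaning. *)
Definition residue x : K := coef (fnum x) (lead (fden x)) / coef (fden x) (lead (fden x)).

(** The two cross products have the same coefficient at [lead q + lead (fden x)], and [coefM_lead]
    evaluates both. *)
Lemma residue_frac p q : q != 0 -> vge (lead q) p ->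
  residue (p%:F / q%:F) = coef p (lead q) / coef q (lead q).
Proof.
move=> q0 v; set x := p%:F / _; have ix : vint x by apply/vint_frac.
have /eqP : p%:F / q%:F = (fnum x)%:F / (fden x)%:F by rewrite -fnumden.
rewrite frac_eq ?fden_neq0 // => /eqP e.
apply/eqP; rewrite eqr_div ?coef_lead ?fden_neq0 //; apply/eqP.
have := coefM_lead v (@vge_lead _ (fden x)).
have := coefM_lead ix (@vge_lead _ q).
by rewrite addrC -e => -> ->.
Qed.

Lemma residueB x y : vint x -> vint y -> residue (x - y) = residue x - residue y.
Proof.
move=> ix iy; rewrite {1}[x]fnumden {1}[y]fnumden frac_sub ?fden_neq0 //.
have [v v'] := vge_cross (fden_neq0 x) (fden_neq0 y) ix iy.
rewrite residue_frac ?mulf_neq0 ?fden_neq0 //; last by apply: vgeD => //; apply: vgeN.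
rewrite leadM ?fden_neq0 // coef_add coef_opp /residue.
rewrite (coefM_lead ix (@vge_lead _ (fden y))).
rewrite (coefM_lead (@vge_lead _ (fden x)) (@vge_lead _ (fden y))).
rewrite [lead (fden x) + _]addrC (coefM_lead iy (@vge_lead _ (fden x))).
by rewrite -[in RHS]mulNr addf_div ?coef_lead ?fden_neq0 // mulNr.
Qed.
Lemma residueM x y : vint x -> vint y -> residue (x * y) = residue x * residue y.
Proof.
move=> ix iy; rewrite {1}[x]fnumden {1}[y]fnumden frac_mul.
rewrite residue_frac ?mulf_neq0 ?fden_neq0 ?leadM ?fden_neq0 //; last exact: vgeM.
by rewrite !coefM_lead //; try exact: vge_lead; rewrite mulf_div.
Qed.
Lemma residue_const (c : K) : residue (ps_mono c 0)%:F = c.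
Proof.
rewrite -[_%:F]divr1 (@residue_frac _ 1) ?oner_neq0 //.
  by rewrite -ps_mono1 lead_mono ?oner_neq0 // !coef_mono eqxx divr1.
by rewrite -ps_mono1 lead_mono ?oner_neq0 //; exact: vge0.
Qed.
(** A nonzero residue forces numerator and denominator to have the same leading monomial. *)
Lemma residue_inv x : vint x -> residue x != 0 -> vint x^-1.
Proof.
move=> ix rx; have c0 : coef (fnum x) (lead (fden x)) != 0.
  by apply: contra_neq rx => c0; rewrite /residue c0 mul0r.
rewrite [x]fnumden invf_div; apply/vint_frac; first exact: coef_neq0 c0.
by rewrite (lead_eq ix c0); exact: vge_lead.
Qed.

(** For nonzero [x], a quotient of monomials with the same value. Such quotients lie in every
    subfield containing the variables, so they link the value groups of the two rings. *)
Definition leadmono x : L := (ps_mono 1 (lead (fnum x)))%:F / (ps_mono 1 (lead (fden x)))%:F.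

Lemma leadmono_neq0 x : leadmono x != 0.
Proof.
by rewrite mulf_neq0 ?invr_eq0 // tofrac_eq0 ps_mono_neq0 ?oner_neq0.
Qed.
Lemma leadmono_assoc x : x != 0 -> vint (x / leadmono x) /\ vint (leadmono x / x).
Proof.
move=> x0; have n0 := fnum_neq0 x0; have d0 := fden_neq0 x.
have m0 m : ps_mono 1 m != 0 :> pseries K by rewrite ps_mono_neq0 ?oner_neq0.
rewrite {1 4}[x]fnumden /leadmono !invf_div !frac_mul; split; apply/vint_frac;
  rewrite ?mulf_neq0 ?leadM ?lead_mono ?oner_neq0 //.
  by rewrite addrC; apply: vgeM; [exact: vge_lead|exact: vge_mono].
by rewrite addrC; apply: vgeM; [exact: vge_mono|exact: vge_lead].
Qed.
End ValuationOfFractions.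

(** * Valuation rings of generated subfields *)

Section GeneratedSubfield.
Variables (K : fieldType) (V : choiceType) (g : V -> pseries K).
Local Notation L := {fraction (pseries K)}.
Implicit Types (P : pred V) (p q : pseries K) (x y : L).

(** Ring elements are encoded as sums of words in constants and generators. This explicit syntax
    makes them countable over a countable alphabet. *)
Definition letter : Type := (K + V)%type.
HB.instance Definition _ := Choice.on letter.
Definition letter_val (a : letter) : pseries K :=
  match a with inl c => ps_mono c 0 | inr v => g v end.
Definition letter_in P (a : letter) : bool := if a is inr v then P v else true.
Definition term_val (t : seq (seq letter)) : pseries K :=
  \sum_(l <- t) \prod_(a <- l) letter_val a.

(** The subring generated by all constants and the [g v] with [P v]; varying [P] allows counting the
    elements that use only certain generators. *)
Definition ring_gen P p := exists2 t, all (all (letter_in P)) t & p = term_val t.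

Lemma ring_genD P p q : ring_gen P p -> ring_gen P q -> ring_gen P (p + q).
Proof.
move=> [s Ps ->] [t Pt ->]; exists (s ++ t); first by rewrite all_cat Ps Pt.
by rewrite /term_val big_cat.
Qed.
Lemma ring_genM P p q : ring_gen P p -> ring_gen P q -> ring_gen P (p * q).
Proof.
move=> [s Ps ->] [t Pt ->]; exists [seq l1 ++ l2 | l1 <- s, l2 <- t].
  apply/allP => l /allpairsP[[l1 l2] /= [l1s l2t ->]].
  by rewrite all_cat (allP Ps) // (allP Pt).
rewrite /term_val big_allpairs_dep big_distrl; apply: eq_bigr => l1 _ /=.
by rewrite big_distrr; apply: eq_bigr => l2 _; rewrite big_cat.
Qed.
Lemma ring_gen_letter P a : letter_in P a -> ring_gen P (letter_val a).
Proof.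
move=> Pa; exists [:: [:: a]]; first by rewrite /= Pa.
by rewrite /term_val !big_seq1.
Qed.
Lemma ring_gen_const P c : ring_gen P (ps_mono c 0).
Proof. exact: (@ring_gen_letter P (inl c)). Qed.
Lemma ring_gen_var P v : P v -> ring_gen P (g v).
Proof. exact: (@ring_gen_letter P (inr v)). Qed.
Lemma ring_gen0 P : ring_gen P 0.
Proof. by exists [::]; rewrite // /term_val big_nil. Qed.
Lemma ring_gen1 P : ring_gen P 1.
Proof. by rewrite -ps_mono1; exact: ring_gen_const. Qed.
Lemma ring_genN P p : ring_gen P p -> ring_gen P (- p).
Proof.
have -> : - p = ps_mono (- 1) 0 * p.
  have -> : ps_mono (- 1) 0 = - 1 :> pseries K.
    apply/pseriesP => m; rewrite coef_opp -ps_mono1 !coef_mono.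
    by case: eqP; rewrite ?oppr0.
  by rewrite mulN1r.
exact/ring_genM/ring_gen_const.
Qed.
Lemma ring_genW P p : ring_gen P p -> ring_gen predT p.
Proof.
move=> [t _ ->]; exists t => //.
by apply/allP => l _; apply/allP => -[].
Qed.

Definition field_gen P x :=
  exists p q, [/\ ring_gen P p, ring_gen P q, q != 0 & x = p%:F / q%:F].

Lemma field_gen_ring P p : ring_gen P p -> field_gen P p%:F.
Proof.
move=> Pp; exists p, 1; split=> //; first exact: ring_gen1.
  exact: oner_neq0.
by rewrite tofrac1 divr1.
Qed.
Lemma field_genB P x y : field_gen P x -> field_gen P y -> field_gen P (x - y).
Proof.
move=> [p [q [Pp Pq q0 ->]]] [p' [q' [Pp' Pq' q'0 ->]]].
rewrite frac_sub //; exists (p * q' - p' * q), (q * q').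
by split; rewrite ?mulf_neq0 //; do ?[apply: ring_genD|apply: ring_genN|apply: ring_genM].
Qed.
Lemma field_genM P x y : field_gen P x -> field_gen P y -> field_gen P (x * y).
Proof.
move=> [p [q [Pp Pq q0 ->]]] [p' [q' [Pp' Pq' q'0 ->]]].
rewrite frac_mul; exists (p * p'), (q * q').
by split; rewrite ?mulf_neq0 //; apply: ring_genM.
Qed.
Lemma field_genV P x : field_gen P x -> field_gen P x^-1.
Proof.
move=> [p [q [Pp Pq q0 ->]]]; rewrite invf_div.
have [->|p0] := eqVneq p 0; last by exists q, p.
by rewrite tofrac0 invr0 mulr0 -tofrac0; apply/field_gen_ring/ring_gen0.
Qed.
Lemma field_genW P x : field_gen P x -> field_gen predT x.
Proof.
by move=> [p [q [Pp Pq q0 ->]]]; exists p, q; split=> //; apply: ring_genW; eassumption.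
Qed.

Definition vring_pred : {pred L} := fun x => `[< vint x /\ field_gen predT x >].

Record vring := Vring { vring_val : L; _ : vring_pred vring_val }.
HB.instance Definition _ := [isSub for vring_val].
HB.instance Definition _ := [Choice of vring by <:].

Lemma vring_subring : GRing.subring_closed vring_pred.
Proof.
split=> [|x y /asboolP[ix Px] /asboolP[iy Py]|x y /asboolP[ix Px] /asboolP[iy Py]].
- by apply/asboolP; split; [exact: vint1|rewrite -tofrac1; exact/field_gen_ring/ring_gen1].
- by apply/asboolP; split; [exact: vintB|exact: field_genB].
- by apply/asboolP; split; [exact: vintM|exact: field_genM].
Qed.
HB.instance Definition _ := GRing.SubChoice_isSubComNzRing.Build L vring_pred vring vring_subring.

Lemma vring_integral_domain : GRing.integral_domain_axiom vring.
Proof.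
move=> a b ab0; rewrite -!(inj_eq val_inj) -mulf_eq0; apply/eqP.
exact: (congr1 val ab0).
Qed.
HB.instance Definition _ := GRing.ComNzRing_hasMulInverse.Build vring
  (@classical_mulVx vring) (@classical_unitPl vring) (@classical_inv_out vring).
HB.instance Definition _ := GRing.ComUnitRing_isIntegral.Build vring vring_integral_domain.

Implicit Types (a b : vring) (u v : {fraction vring}).

Lemma vval_eq0 a : (val a == 0) = (a == 0).
Proof. exact: (inj_eq val_inj a 0). Qed.
Lemma vvalM a b : val (a * b) = val a * val b. Proof. by []. Qed.
Lemma vvalB a b : val (a - b) = val a - val b. Proof. by []. Qed.
Lemma vringP a : vint (val a) /\ field_gen predT (val a).
Proof. exact/asboolP/(valP a). Qed.
Lemma vring_lift x : vint x -> field_gen predT x -> exists a, val a = x.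
Proof.
move=> ix gx; have xP : vring_pred x by apply/asboolP.
by exists (Vring xP).
Qed.

(* The fraction field of [vring] is realised inside the fraction field of the
   power series ring, where divisibility is read off the valuation. *)
Definition fval u : L := val (fnum u) / val (fden u).

Lemma fval_frac a b : b != 0 -> fval (a%:F / b%:F) = val a / val b.
Proof.
move=> b0; set u := a%:F / _.
have /eqP : a%:F / b%:F = (fnum u)%:F / (fden u)%:F by rewrite -fnumden.
rewrite frac_eq ?fden_neq0 // => /eqP e.
apply/eqP; rewrite eqr_div ?vval_eq0 ?fden_neq0 //.
by rewrite -!vvalM e.
Qed.
Lemma fval_emb a : fval a%:F = val a.
Proof. by rewrite -[a%:F]divr1 (@fval_frac a 1) ?oner_neq0 // divr1. Qed.
Lemma fvalM u v : fval (u * v) = fval u * fval v.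
Proof.
rewrite {1}[u]fnumden {1}[v]fnumden mulf_div -!tofracM fval_frac ?mulf_neq0 ?fden_neq0 //.
by rewrite !vvalM mulf_div.
Qed.
Lemma fval_inj : injective fval.
Proof.
move=> u v /eqP; rewrite eqr_div ?vval_eq0 ?fden_neq0 // -!vvalM (inj_eq val_inj) => e.
by apply/eqP; rewrite [u]fnumden [v]fnumden frac_eq ?fden_neq0.
Qed.
Lemma fval_eq0 u : (fval u == 0) = (u == 0).
Proof. by rewrite -(inj_eq fval_inj u) -tofrac0 fval_emb. Qed.
Lemma fval_neq0 u : u != 0 -> fval u != 0.
Proof. by rewrite fval_eq0. Qed.
Lemma fval_gen u : field_gen predT (fval u).
Proof.
by apply: field_genM; [|apply: field_genV]; apply: (vringP _).2.
Qed.
(** A quotient of elements of the subfield stays in the subfield, so integrality is the only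
    obstruction to lifting it to the ring. *)
Lemma vdivE u v : u != 0 -> vdiv u v <-> vint (fval v / fval u).
Proof.
move=> u0; split=> [[r ->]|iv].
  by rewrite fvalM fval_emb mulfK ?fval_eq0 //; exact: (vringP r).1.
have [|r er] := vring_lift iv; first exact/field_genM/field_genV/fval_gen/fval_gen.
exists r; apply: fval_inj; rewrite fvalM fval_emb er divfK ?fval_eq0 //.
Qed.
Lemma dvdRE a b : a != 0 -> dvdR a b <-> vint (val b / val a).
Proof.
move=> a0; have va0 : val a != 0 by rewrite vval_eq0.
split=> [[r ->]|iv]; first by rewrite vvalM mulrC mulKf //; exact: (vringP r).1.
have [|r er] := vring_lift iv.
  by apply: field_genM; [|apply: field_genV]; apply: (vringP _).2.
by exists r; apply: val_inj; rewrite vvalM er mulrC divfK.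
Qed.
End GeneratedSubfield.

(** * Countability and cardinality aleph_1 *)

Lemma countable_preimage (T U : Type) (f : T -> U) (A : set T) (B : set U) :
  countable B -> {in A &, injective f} -> (forall x, A x -> B (f x)) -> countable A.
Proof.
move=> /countable_injP[h hinj] finj AB; apply/countable_injP; exists (h \o f).
move=> x y Ax Ay /hinj e; apply: finj => //; apply: e; apply/mem_set/AB/set_mem => //.
Qed.

Lemma countable_all (T : Type) (P : pred T) :
  countable [set x | P x] -> countable [set s | all P s].
Proof.
move=> /countable_injP[f finj].
apply: (@countable_preimage _ _ (map f) _ setT) => //.
move=> s t /set_mem /= + /set_mem /=.
elim: s t => [|x s IH] [|y t] //= /andP[Px Ps] /andP[Py Pt] [exy est].
congr (_ :: _); last exact: IH.
by apply: (finj x y _ _ exy); apply/mem_set.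
Qed.

Lemma omega1_inj_uncountable (T : Type) (f : omega1 -> T) :
  injective f -> ~ countable [set: T].
Proof.
move=> finj cT; apply: omega1_uncountable.
by apply: (countable_preimage (f := f) cT) => // x y _ _; exact: finj.
Qed.

Lemma wo_aleph1_omega1 : wo_aleph1 [set: omega1] (fun u w => (u < w)%O).
Proof.
split=> //.
- by move=> x _; rewrite ltxx.
- by move=> x y z _ _ _; exact: lt_trans.
- by move=> x y _ _; case: (ltgtP x y); auto.
- move=> B _ /omega1_min[m Bm mmin]; exists m; split=> // y /mmin.
  by rewrite leNgt => /negP.
- exact: omega1_uncountable.
- by move=> w _; apply: sub_countable (omega1_segment w); apply: subset_card_le => u [].
Qed.

(** Elements are ordered by rank, ties being broken by an enumeration of the countable set of
    elements of at most that rank. An initial segment then lies in one such set. *)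
Lemma aleph1_rank (T : Type) (rk : T -> omega1) :
  (forall w, countable [set x | (rk x <= w)%O]) -> ~ countable [set: T] ->
  aleph1 [set: T].
Proof.
move=> crk ucT.
have /choice[e einj] w : exists f : T -> nat, {in [set x | (rk x <= w)%O] &, injective f}.
  exact/countable_injP.
have einj' x y : rk x = rk y -> e (rk x) x = e (rk y) y -> x = y.
  by move=> rxy; rewrite rxy => /einj; apply; apply/mem_set; rewrite /= ?rxy.
exists (fun x y => (rk x < rk y)%O \/ rk x = rk y /\ (e (rk x) x < e (rk y) y)%N).
split=> //.
- by move=> x _ [|[_]]; rewrite ?ltxx ?ltnn.
- move=> x y z _ _ _ [xy|[rxy exy]] [yz|[ryz eyz]].
  + by left; exact: lt_trans yz.
  + by left; rewrite -ryz.
  + by left; rewrite rxy.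
  + by right; split; [rewrite rxy|exact: ltn_trans eyz].
- move=> x y _ _; have [rxy|rxy|rxy] := ltgtP (rk x) (rk y).
  + by right; left; left.
  + by right; right; left.
  have [exy|exy|exy] := ltngtP (e (rk x) x) (e (rk y) y).
  + by right; left; right.
  + by right; right; right.
  + by left; exact: einj'.
- move=> B _ [x Bx].
  have [|_ [y By <-] rmin] := omega1_min (B := [set rk x | x in B]).
    by exists (rk x); exists x.
  (* Among the elements of [B] of minimal rank, the one with the smallest code is least. *)
  pose N n := `[< exists z, [/\ B z, rk z = rk y & e (rk z) z = n] >].
  have exN : exists n, N n by exists (e (rk y) y); apply/asboolP; exists y.
  case: (ex_minnP exN) => n /asboolP[z [Bz rz ez]] nmin.
  exists z; split=> // v Bv; rewrite rz => -[|[rv]].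
    by apply/negP; rewrite -leNgt; apply: rmin; exists v.
  apply/negP; rewrite -leqNgt -rz ez; apply: nmin; apply/asboolP.
  by exists v.
- move=> x _; apply: sub_countable (crk (rk x)); apply: subset_card_le => y [_ /=].
  by case=> [/ltW|[->]].
Qed.

(** * The valuation rings generated by the variables and a family of series *)

Section Bounded.
Variables (K : fieldType) (s : omega1 -> pseries K).
Local Notation L := {fraction (pseries K)}.

(** The left summand gives the variables, the right one the adjoined series. The zero family adjoins
    nothing, so both rings are instances of one construction. *)
Definition gens (v : omega1 + omega1) : pseries K :=
  match v with inl w => ps_mono 1 (var w) | inr w => s w end.
Definition index (v : omega1 + omega1) : omega1 :=
  match v with inl w => w | inr w => w end.
Definition bounded (w : omega1) : pred (omega1 + omega1) := fun v => (index v <= w)%O.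

Lemma ring_gen_mono (P : pred (omega1 + omega1)) (c : K) (m : mono) :
  (forall w : omega1, (0 < m w)%N -> P (inl w)) -> ring_gen gens P (ps_mono c m).
Proof.
elim/mono_ind: m c => [|w m IH] c Pm; first exact: ring_gen_const.
rewrite -[c]mul1r -ps_monoM; apply: ring_genM.
  apply: (@ring_gen_var _ _ gens P (inl w)); apply: Pm.
  by rewrite monoDE varE eqxx.
by apply: IH => u mu; apply: Pm; rewrite monoDE addn_gt0 mu orbT.
Qed.

Lemma ring_gen_monoT (c : K) (m : mono) : ring_gen gens predT (ps_mono c m).
Proof. exact: ring_gen_mono. Qed.

Lemma ring_gen_sub (P P' : pred (omega1 + omega1)) p :
  {subset P <= P'} -> ring_gen gens P p -> ring_gen gens P' p.
Proof.
move=> sub [t Pt ->]; exists t => //; apply/allP => l /(allP Pt) Pl.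
by apply/allP => a /(allP Pl); case: a => //= v; exact: sub.
Qed.
Lemma field_gen_sub (P P' : pred (omega1 + omega1)) x :
  {subset P <= P'} -> field_gen gens P x -> field_gen gens P' x.
Proof.
move=> sub [p [q [Pp Pq q0 ->]]]; exists p, q.
by split=> //; apply: (ring_gen_sub sub).
Qed.
Lemma bounded_sub w w' : (w <= w')%O -> {subset bounded w <= bounded w'}.
Proof. by move=> ww' v; rewrite /in_mem /=; move=> h; exact: le_trans ww'. Qed.

Lemma ring_gen_bounded p : ring_gen gens predT p -> exists w, ring_gen gens (bounded w) p.
Proof.
move=> [t _ ->].
pose ix := pmap (fun a : letter K (omega1 + omega1)%type =>
  if a is inr v then Some (index v) else None) (flatten t).
have [w wP] := seq_bounded ix; exists w, t => //.
apply/allP => l lt; apply/allP => -[//|v] vl /=; apply/ltW/wP.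
rewrite mem_pmap; apply/mapP; exists (inr v) => //.
by apply/flattenP; exists l.
Qed.
Lemma field_gen_bounded x : field_gen gens predT x -> exists w, field_gen gens (bounded w) x.
Proof.
move=> [p [q [/ring_gen_bounded[w Pp] /ring_gen_bounded[w' Pq] q0 ->]]].
exists (Order.max w w'), p, q; split=> //.
  by apply: ring_gen_sub Pp; apply: bounded_sub; rewrite le_max lexx.
by apply: ring_gen_sub Pq; apply: bounded_sub; rewrite le_max lexx orbT.
Qed.

Hypothesis cK : countable [set: K].

Lemma countable_letters w : countable [set a | letter_in (K := K) (bounded w) a].
Proof.
have /countable_injP[f finj] := cK.
have /countable_injP[h hinj] := omega1_initial w.
pose code (a : letter K (omega1 + omega1)%type) : nat + (nat + nat) :=
  match a with inl c => inl (f c) | inr (inl u) => inr (inl (h u))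
  | inr (inr u) => inr (inr (h u)) end.
apply: (@countable_preimage _ _ code _ setT) => // a b /set_mem /= + /set_mem /=.
case: a b => [a|[a|a]] [b|[b|b]] //= ha hb [] e.
- by rewrite (finj a b) ?in_setT.
- by rewrite (hinj a b) //; apply/mem_set.
- by rewrite (hinj a b) //; apply/mem_set.
Qed.

(** Each such fraction is the value of a pair of terms over a countable alphabet. *)
Lemma countable_field_gen w : countable [set x | field_gen gens (bounded w) x].
Proof.
have ct := countable_all (countable_all (countable_letters w)).
pose tv := @term_val K _ gens.
apply: sub_countable (countableX ct ct).
apply: (card_le_trans _ (card_image_le (fun t => (tv t.1)%:F / (tv t.2)%:F) _)).
apply: subset_card_le => x [p [q [[t Pt ->] [t' Pt' ->] _ ->]]].
by exists (t, t').
Qed.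

(** The rank of [x] is an index bounding the generators in some expression of [f x]. This serves
    both the ring and its quotient field. *)
Lemma aleph1_field_gen (T : Type) (f : T -> L) : injective f ->
  (forall x, field_gen gens predT (f x)) -> ~ countable [set: T] -> aleph1 [set: T].
Proof.
move=> finj gf; have /choice[rk rkP] x := field_gen_bounded (gf x).
apply: (aleph1_rank (rk := rk)) => w.
apply: (countable_preimage (f := f) (countable_field_gen w)).
  by move=> x y _ _; exact: finj.
by move=> x /= rx; apply: field_gen_sub (rkP x); exact: bounded_sub.
Qed.

Notation R := (vring gens).

Lemma xmono_spec : {f : mono -> R | forall m, val (f m) = (ps_mono 1 m)%:F}.
Proof.
suff /choice[f fP] m : exists a : R, val a = (ps_mono 1 m)%:F by exists f.
exact/vring_lift/field_gen_ring/ring_gen_monoT/vint_ps.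
Qed.
Definition xmono := sval xmono_spec.
Definition xvar w := xmono (var w).
Lemma val_xmono m : val (xmono m) = (ps_mono 1 m)%:F.
Proof. exact: (svalP xmono_spec). Qed.
Lemma xmono_neq0 m : xmono m != 0.
Proof. by rewrite -vval_eq0 val_xmono tofrac_eq0 ps_mono_neq0 ?oner_neq0. Qed.

Lemma dvd_xmono m n : dvdR (xmono m) (xmono n) <-> (m <= n)%O.
Proof.
have m0 k : ps_mono 1 k != 0 :> pseries K by rewrite ps_mono_neq0 ?oner_neq0.
rewrite dvdRE ?xmono_neq0 // !val_xmono; split.
  move=> /vint_frac; rewrite m0 lead_mono ?oner_neq0 // => /(_ isT) v.
  by rewrite -[n in (_ <= n)%O](@lead_mono K 1) ?oner_neq0 //; exact: vge_le_lead.
move=> mn; apply/vint_frac => //; rewrite lead_mono ?oner_neq0 //.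
exact: vge_le mn (@vge_mono _ _ _).
Qed.

Lemma xvar_inj : injective xvar.
Proof.
move=> w v e; apply: var_inj; apply/eqP; rewrite eq_le.
have refl m : dvdR (xmono m) (xmono m) by apply/dvd_xmono.
by apply/andP; split; apply/dvd_xmono; move: e; rewrite /xvar => ->.
Qed.

Lemma vring_uncountable : ~ countable [set: R].
Proof. exact: omega1_inj_uncountable xvar_inj. Qed.

Lemma vfrac_uncountable : ~ countable [set: {fraction R}].
Proof.
apply: (omega1_inj_uncountable (f := fun w => (xvar w)%:F)) => w v /eqP.
by rewrite tofrac_eq => /eqP/xvar_inj.
Qed.

Lemma aleph1_vring : aleph1 [set: R].
Proof.
apply: (aleph1_field_gen (f := val)) vring_uncountable; first exact: val_inj.
by move=> a; exact: (vringP a).2.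
Qed.

Lemma aleph1_vfrac : aleph1 [set: {fraction R}].
Proof.
apply: (aleph1_field_gen (f := @fval _ _ gens)) vfrac_uncountable.
  exact: fval_inj.
exact: fval_gen.
Qed.

Lemma dvdR_total (a b : R) : dvdR a b \/ dvdR b a.
Proof.
have [->|a0] := eqVneq a 0; first by right; exists 0; rewrite mulr0.
have [->|b0] := eqVneq b 0; first by left; exists 0; rewrite mulr0.
case: (vint_total (val b / val a)) => h; [left|right]; apply/dvdRE => //.
by rewrite -invf_div.
Qed.

(** A variable beyond the leading monomial of the denominator multiplies [q] into the ring. *)
Lemma xvar_frac (q : {fraction R}) : exists w (a : R), q = a%:F / (xvar w)%:F.
Proof.
have [w dw] := mono_bounded (lead (fden (fval q))).
have q0 := fden_neq0 (fval q).
have x0 : (xvar w)%:F != 0 :> {fraction R} by rewrite tofrac_eq0 xmono_neq0.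
have : vdiv ((xvar w)%:F)^-1 q.
  apply/vdivE; first by rewrite invr_eq0.
  have -> : fval ((xvar w)%:F)^-1 = ((ps_mono 1 (var w))%:F)^-1 :> L.
    by rewrite -div1r -tofrac1 fval_frac ?xmono_neq0 // val_xmono div1r.
  rewrite invrK [fval q]fnumden mulrAC -tofracM; apply/vint_frac => //.
  (* The numerator has value at least 0, hence its product with the variable has value at least
     [var w]. *)
  apply: (@vge_le _ _ (0 + var w)); first by rewrite add0r ltW.
  by apply: vgeM; [exact: vge0|exact: vge_mono].
by move=> [a ->]; exists w, a.
Qed.

Lemma xvar_presentation : Q_presentation (fun u w : omega1 => (u < w)%O) xvar.
Proof.
split; first exact: wo_aleph1_omega1.
split; first by move=> w; exact: xmono_neq0.
split; last exact: xvar_frac.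
move=> t w tw; split; first by apply/dvd_xmono/ltW; rewrite var_lt.
by move=> /dvd_xmono; rewrite leNgt var_lt tw.
Qed.

(** Since countable sets of indices are bounded, one variable with index [u] clears the denominators
    of all of [S], hence of all combinations. It does not clear the inverse of the variable with
    index [v > u]. *)
Lemma vfrac_not_countably_generated (S : set {fraction R}) :
  countable S -> ~ generates S.
Proof.
move=> cS gS.
have /choice[h hP] q := xvar_frac q.
have [u uP] : exists u, forall w, (h @` S) w -> (w < u)%O.
  apply: countable_bounded; apply: sub_countable cS; exact: card_image_le.
have [v uv] := countable_bounded (countable1 u); have {}uv := uv u erefl.
have xu0 w : (xvar w)%:F != 0 :> {fraction R} by rewrite tofrac_eq0 xmono_neq0.
have Su q : S q -> exists a : R, (xvar u)%:F * q = a%:F.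
  move=> Sq; have [a qa] := hP q.
  have : dvdR (xvar (h q)) (xvar u).
    by apply/dvd_xmono/ltW; rewrite var_lt; apply: uP; exists q.
  move=> [b ub]; exists (b * a); rewrite qa ub !tofracM [in LHS]mulrC.
  by rewrite -mulrA mulKf // mulrC.
have [n [c [t [tS e]]]] := gS ((xvar v)%:F)^-1.
have [a ea] : exists a : R, (xvar u)%:F * ((xvar v)%:F)^-1 = a%:F.
  rewrite e mulr_sumr; elim/big_ind: _ => [|x y [a ->] [b ->]|i _].
  - by exists 0; rewrite tofrac0.
  - by exists (a + b); rewrite tofracD.
  - by have [a ea] := Su _ (tS i); exists (c i * a); rewrite mulrCA ea tofracM.
have : dvdR (xvar v) (xvar u).
  exists a; apply/eqP; rewrite -tofrac_eq tofracM -ea mulrCA.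
  by rewrite -[X in X == _]mulr1 -(mulfV (xu0 v)) eqxx.
by move=> /dvd_xmono; rewrite leNgt var_lt uv.
Qed.

Lemma vring_valuation_domain : valuation_domain R.
Proof.
split.
  move=> I J [_ [_ mulI]] [_ [_ mulJ]].
  have [|/existsNP[a]] := pselect (I `<=` J); first by left.
  move=> /not_implyP[Ia nJa]; right => b Jb.
  case: (dvdR_total a b) => [[c ->]|[c e]].
    by rewrite mulrC; exact: mulI.
  by case: nJa; rewrite e mulrC; exact: mulJ.
(* If the inverse of a variable were in the ring, that variable would divide the monomial 1. *)
exists ((xvar omega1_0)%:F)^-1 => r e.
have x0 : (xvar omega1_0)%:F != 0 :> {fraction R} by rewrite tofrac_eq0 xmono_neq0.
have : dvdR (xvar omega1_0) (xmono 0).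
  exists r; apply/eqP; rewrite -tofrac_eq tofracM -e mulfV //.
  rewrite -tofrac1 tofrac_eq; apply/eqP/val_inj.
  by rewrite val_xmono ps_mono1 tofrac1.
move=> /dvd_xmono; rewrite leNgt => /negP; apply.
by apply: lt_var => u _; rewrite mono0E.
Qed.

Definition vresidue (a : R) : K := residue (val a).

Lemma vresidue_zmod : zmod_morphism vresidue.
Proof.
by move=> a b; rewrite /vresidue vvalB residueB //; exact: (vringP _).1.
Qed.
Lemma vresidue_monoid : monoid_morphism vresidue.
Proof.
split=> [|a b]; last by rewrite /vresidue vvalM residueM //; exact: (vringP _).1.
by rewrite /vresidue -[val 1]tofrac1 -ps_mono1 residue_const.
Qed.
HB.instance Definition _ := GRing.isZmodMorphism.Build R K vresidue vresidue_zmod.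
HB.instance Definition _ := GRing.isMonoidMorphism.Build R K vresidue vresidue_monoid.

Lemma vring_residue_field : residue_field_iso R K.
Proof.
exists vresidue; split.
  move=> c; have [|a ea] := @vring_lift _ _ gens _ (@vint_ps _ (ps_mono c 0)).
    exact/field_gen_ring/ring_gen_const.
  by exists a; rewrite /= /vresidue ea residue_const.
split; [split; [|split]|split].
- exact: (rmorph0 vresidue).
- by move=> a b /= ea eb; rewrite (rmorphD vresidue) /= ea eb addr0.
- by move=> r a /= ea; rewrite (rmorphM vresidue) /= ea mulr0.
- by rewrite /= (rmorph1 vresidue) => /eqP; rewrite oner_eq0.
move=> J [_ [_ mulJ]] sub.
have [subJ|/existsNP[a]] := pselect (J `<=` [set r | vresidue r = 0]).
  by left; apply/seteqP.
(* An element of [J] with nonzero residue is a unit, which puts 1 in [J]. *)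
move=> /not_implyP[Ja /eqP ra]; right.
have a0 : a != 0 by apply: contra_neq ra => ->; exact: (rmorph0 vresidue).
have [c ec] : dvdR a 1.
  apply/dvdRE => //; rewrite [val 1](_ : _ = 1) // div1r.
  by apply: residue_inv ra; exact: (vringP a).1.
by rewrite ec mulrC; exact: mulJ.
Qed.
End Bounded.

(** * Comparison of the two rings *)

Section SameValueGroup.
Variables (K : fieldType) (s s' : omega1 -> pseries K).
Local Notation R := (vring (gens s)).
Local Notation R' := (vring (gens s')).
Local Notation L := {fraction (pseries K)}.

(** The monomial quotient [leadmono (fval x)], rebuilt in the other ring. *)
Definition value_iso (x : {fraction R}) : {fraction R'} :=
  (xmono s' (lead (fnum (fval x))))%:F / (xmono s' (lead (fden (fval x))))%:F.

Lemma fval_value_iso x : fval (value_iso x) = leadmono (fval x).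
Proof. by rewrite fval_frac ?xmono_neq0 // !val_xmono. Qed.

Lemma value_iso_neq0 x : value_iso x != 0.
Proof. by rewrite -fval_eq0 fval_value_iso; exact: leadmono_neq0. Qed.

Lemma vint_trans (x y z : L) : y != 0 -> vint (y / x) -> vint (z / y) -> vint (z / x).
Proof.
move=> y0 yx zy; have -> : z / x = (z / y) * (y / x) by rewrite mulrA divfK.
exact: vintM.
Qed.

Lemma vint_mulf (x x' y y' : L) :
  vint (x / x') -> vint (y / y') -> vint (x * y / (x' * y')).
Proof. by rewrite -mulf_div; exact: vintM. Qed.

(** Nonzero [x] and [leadmono x] differ by a unit of the valuation ring, so each clause follows by
    passing between the two with [vint_trans]. *)
Lemma vring_same_value_group : same_value_group R R'.
Proof.
exists value_iso; split; [|split; [|split]].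
- by move=> x _; exact: value_iso_neq0.
- move=> x y x0 y0.
  have fx0 := fval_neq0 x0.
  have fy0 := fval_neq0 y0.
  have fxy0 := mulf_neq0 fx0 fy0.
  have [ax bx] := leadmono_assoc fx0; have [ay by_] := leadmono_assoc fy0.
  have [axy bxy] := leadmono_assoc fxy0.
  have psi0 := mulf_neq0 (value_iso_neq0 x) (value_iso_neq0 y).
  split.
    apply/(vdivE _ (value_iso_neq0 _)); rewrite fvalM !fval_value_iso fvalM.
    exact: vint_trans fxy0 axy (vint_mulf bx by_).
  apply/(vdivE _ psi0); rewrite (fvalM (value_iso x)) !fval_value_iso fvalM.
  exact: vint_trans fxy0 (vint_mulf ax ay) bxy.
- move=> x y x0 y0.
  have fx0 := fval_neq0 x0.
  have fy0 := fval_neq0 y0.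
  have [ax bx] := leadmono_assoc fx0; have [ay by_] := leadmono_assoc fy0.
  rewrite (vdivE _ x0) (vdivE _ (value_iso_neq0 x)) !fval_value_iso.
  have lx0 := leadmono_neq0 (fval x); have ly0 := leadmono_neq0 (fval y).
  split=> h; first exact: vint_trans fx0 ax (vint_trans fy0 h by_).
  exact: vint_trans lx0 bx (vint_trans ly0 h ay).
- move=> z z0; have fz0 := fval_neq0 z0.
  (* The preimage is the monomial quotient with the value of [z], formed in the first ring. *)
  pose x : {fraction R} :=
    (xmono s (lead (fnum (fval z))))%:F / (xmono s (lead (fden (fval z))))%:F.
  have ex : fval x = leadmono (fval z).
    by rewrite fval_frac ?xmono_neq0 // !val_xmono.
  have x0 : x != 0 by rewrite -fval_eq0 ex; exact: leadmono_neq0.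
  exists x; split=> //.
  have fx0 := fval_neq0 x0.
  have [az bz] := leadmono_assoc fz0; have [ax bx] := leadmono_assoc fx0.
  rewrite ex in ax bx fx0.
  split; [apply/vdivE; first exact: value_iso_neq0|apply/(vdivE _ z0)];
    rewrite fval_value_iso ex.
    exact: vint_trans fx0 ax az.
  exact: vint_trans fx0 bz bx.
Qed.
End SameValueGroup.

(** * Countable quotients of the ring generated by the variables alone *)

Section StronglyCountable.
Variable K : fieldType.
Local Notation s0 := (fun _ : omega1 => 0 : pseries K).
Local Notation R := (vring (gens s0)).
Local Notation L := {fraction (pseries K)}.
Variable w : omega1.
Implicit Types (m n u : mono) (p q : pseries K).

Definition high m : mono := mono_filter (fun v => (w < v)%O) m.
Definition low m : mono := mono_filter (fun v => (v <= w)%O) m.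

Lemma high_low m : m = high m + low m.
Proof.
apply/monoP => v; rewrite monoDE !mono_filterE.
by case: (leP v w); rewrite ?addn0.
Qed.

(** As the high parts differ, the variable [v] deciding [u < n] exceeds [w]. Adding [var w] changes
    only the exponent at [w], so [v] still decides. *)
Lemma lt_high u n : (u < n)%O -> high n <> high u -> ((u + var w : mono)%R < n)%O.
Proof.
move=> /mltP[v uv ab] hn; apply/mltP; exists v.
  rewrite monoDE varE; case: eqP => [e|_]; last by rewrite addn0.
  case: hn; apply/monoP => x; rewrite !mono_filterE.
  by case: ifP => // wx; rewrite ab // e.
case: (leP v w) => vw x vx; last first.
  by rewrite monoDE varE gt_eqF ?addn0 ?ab // (lt_trans vw vx).
case: hn; apply/monoP => y; rewrite !mono_filterE.
by case: ifP => // wy; rewrite ab // (le_lt_trans vw wy).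
Qed.

(** If [p] has value at least [u], then by [lt_high] this retains every term of [p] below
    [u + var w]: it is [p] up to the precision needed modulo the variable [w]. *)
Definition slice u p : pseries K := fun n => if high n == high u then coef p n else 0.
Lemma coef_slice u p n : coef (slice u p) n = if high n == high u then coef p n else 0.
Proof. by []. Qed.

(** Slicing is additive, so words suffice. A word is a single scaled monomial; its slice is zero
    unless its high part is [high u], and then the other factor involves only variables up to
    [w]. *)
Lemma slice_factor u p : ring_gen (gens s0) predT p -> exists p',
  ring_gen (gens s0) (bounded w) p' /\ slice u p = ps_mono 1 (high u) * p'.
Proof.
move=> [t _ ->]; rewrite /term_val.
elim/big_ind: _ => [|{}p q [p' [Pp ep]] [q' [Pq eq]]|l _].
- exists 0; split; first exact: ring_gen0.
  by rewrite mulr0; apply/pseriesP => n; rewrite coef_slice if_same.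
- exists (p' + q'); split; first exact: ring_genD.
  rewrite mulrDr -ep -eq; apply/pseriesP => n; rewrite coef_add !coef_slice.
  by case: eqP; rewrite ?addr0.
(* The adjoined series are all zero, so every letter is a scaled monomial. *)
have [c [m ->]] : exists c m, \prod_(a <- l) letter_val (gens s0) a = ps_mono c m.
  elim/big_ind: _ => [|{}p q [b [m ->]] [c [n ->]]|[c|[v|v]] _ /=].
  - by exists 1, 0.
  - by exists (b * c), (m + n); rewrite ps_monoM.
  - by exists c, 0.
  - by exists 1, (var v).
  - exists 0, 0; apply/pseriesP => n; rewrite coef_mono if_same //.
have [hm|hm] := eqVneq (high m) (high u).
  exists (ps_mono c (low m)); split.
    apply: ring_gen_mono => v; rewrite mono_filterE /bounded /=.
    by case: ifP.
  rewrite ps_monoM mul1r -hm -high_low; apply/pseriesP => n.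
  rewrite coef_slice coef_mono; case: (n =P m) => [->|_]; last by rewrite if_same.
  by rewrite hm eqxx.
exists 0; split; first exact: ring_gen0.
rewrite mulr0; apply/pseriesP => n; rewrite coef_slice coef_mono.
by case: (n =P m) => [->|_]; rewrite ?if_same // (negbTE hm).
Qed.

Lemma vge_slice u p : vge u p -> vge u (slice u p).
Proof. by move=> v n nu; rewrite coef_slice v // if_same. Qed.

Lemma vge_sub_slice u p : vge u p -> vge (u + var w) (p - slice u p).
Proof.
move=> v n nu; rewrite coef_add coef_opp coef_slice.
case: eqP => hn; first by rewrite subrr.
rewrite subr0; apply: v; rewrite ltNge le_eqVlt; apply/negP => /orP[/eqP e|un].
  by rewrite e in hn.
by have := lt_trans nu (lt_high un hn); rewrite ltxx.
Qed.

(** Representatives are the ring elements generated by indices up to [w]. For [a = p/q], slice both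
    series at [u = lead q]; the common factor [high u] cancels and leaves [p'/q'] with such
    generators. *)
Lemma quot_countable_xvar : countable [set: K] ->
  quot_countable [set: R] (mulset (xvar s0 w)).
Proof.
move=> cK; exists [set a : R | field_gen (gens s0) (bounded w) (val a)].
split.
  apply: (countable_preimage (f := val) (countable_field_gen s0 cK w)) => //.
  by move=> a b _ _; exact: val_inj.
split=> // a _; have [ia [p [q [Pp Pq q0 ea]]]] := vringP a.
set u := lead q; have vp : vge u p by apply/(vint_frac p q0); rewrite -ea.
have vq : vge u q := @vge_lead _ q.
have [p' [Pp' ep]] := slice_factor u Pp; have [q' [Pq' eq]] := slice_factor u Pq.
set h := ps_mono 1 _ in ep eq.
have cq0 : coef (slice u q) u != 0 by rewrite coef_slice eqxx coef_lead.
have sq0 := coef_neq0 cq0.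
have lsq : lead (slice u q) = u by apply: lead_eq => //; exact: vge_slice.
have /andP[h0 q'0] : (h != 0) && (q' != 0) by rewrite -negb_or -mulf_eq0 -eq.
have ec : p'%:F / q'%:F = (slice u p)%:F / (slice u q)%:F.
  by rewrite ep eq !tofracM -mulf_div divff ?mul1r ?tofrac_eq0.
have gc : field_gen (gens s0) (bounded w) (p'%:F / q'%:F) by exists p', q'.
have [||c vc] := @vring_lift _ _ (gens s0) (p'%:F / q'%:F).
- by rewrite ec; apply/vint_frac => //; rewrite lsq; exact: vge_slice.
- exact: field_genW gc.
exists c; first by rewrite /= vc.
suff [r er] : dvdR (xvar s0 w) (a - c) by exists r.
apply/dvdRE; first exact: xmono_neq0.
rewrite vvalB ea vc ec frac_sub // val_xmono -mulrA -invfM -tofracM.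
have x0 : ps_mono 1 (var w) != 0 :> pseries K by rewrite ps_mono_neq0 ?oner_neq0.
apply/vint_frac; first by rewrite !mulf_neq0.
rewrite !leadM ?mulf_neq0 // lead_mono ?oner_neq0 // lsq -/u.
(* Each summand has one factor of value at least [u] and one of value at least [u + var w], which
   matches the leading monomial of the denominator. *)
have -> : p * slice u q - slice u p * q =
   (p - slice u p) * slice u q - slice u p * (q - slice u q) by ring.
apply: vgeD; last apply: vgeN.
  rewrite (_ : _ + _ = (u + var w) + u); last by rewrite addrAC.
  by apply: vgeM; [exact: vge_sub_slice|exact: vge_slice].
rewrite -addrA; apply: vgeM; [exact: vge_slice|exact: vge_sub_slice].
Qed.
End StronglyCountable.

(** * Uncountable quotients from 0/1-series in one variable *)

Section EssentiallyUncountable.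
Variable K : fieldType.
Local Notation t := (var omega1_0).

(** The stream underlying [w], read as the coefficients of the powers of one variable; distinct
    indices are distinct streams and give distinct series. *)
Definition bit_series (w : omega1) : pseries K :=
  fun n => if `[< exists2 k, n = t *+ k & val w k >] then 1 else 0.

Lemma coef_varn (v : omega1) k (u : omega1) : (var v *+ k : mono) u = if u == v then k else 0%N.
Proof.
elim: k => [|k IH]; first by rewrite mulr0n mono0E if_same.
by rewrite mulrS monoDE varE IH; case: eqP.
Qed.

Lemma coef_bit_series w k : coef (bit_series w) (t *+ k) = (val w k)%:R.
Proof.
rewrite /coef /bit_series; case: asboolP => [[j e wj]|nk]; last first.
  by case wk: (val w k) => //; case: nk; exists k.
have /monoP/(_ omega1_0) := e; rewrite !coef_varn eqxx => ->.
by rewrite wj.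
Qed.

(** The witness bounds the value of the difference by a power of [t], which lies below every later
    variable. *)
Lemma bit_series_neq w w' : w <> w' ->
  exists k, coef (bit_series w - bit_series w') (t *+ k) != 0.
Proof.
move=> ww'; have [k wk] : exists k, val w k != val w' k.
  apply: contrapT => nk; apply: ww'; apply: val_inj; apply/funext => k.
  by apply/eqP; apply: contrapT => /negP h; apply: nk; exists k.
exists k; rewrite coef_add coef_opp !coef_bit_series.
by move: wk; case: (val w k); case: (val w' k) => //= _;
  rewrite ?mulr0n ?subr0 ?sub0r ?oppr_eq0 oner_eq0.
Qed.

Local Notation R := (vring (gens bit_series)).

(** The products of the variable [u] with the series are pairwise incongruent modulo the variable
    [v]: a difference has value at most [var u + t *+ k], which is below [var v] since [v] exceeds
    [u] and [omega1_0]. Hence [omega1] would inject into [C]. *)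
Lemma quot_uncountable_xvar (u v : omega1) : (u < v)%O -> (omega1_0 < v)%O ->
  ~ quot_countable (mulset (xvar bit_series u)) (mulset (xvar bit_series v)).
Proof.
move=> uv v0 [C [cC [_ CP]]].
have /choice[b bP] w : exists b : R, val b = (bit_series w)%:F.
  apply: vring_lift; first exact: vint_ps.
  exact/field_gen_ring/(@ring_gen_var _ _ (gens bit_series) predT (inr w)).
have /choice[c cP] w : exists c, C c /\
    mulset (xvar bit_series v) (xvar bit_series u * b w - c).
  by have [|c Cc cm] := CP (xvar bit_series u * b w); [exists (b w)|exists c].
apply: omega1_uncountable; apply: (countable_preimage (f := c) cC) => [|w _]; last first.
  by case: (cP w).
move=> w w' _ _ ecc; apply: contrapT => /bit_series_neq[k dk].
have [_ [y _ ey]] := cP w; have [_ [y' _ ey']] := cP w'.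
have : dvdR (xvar bit_series v) (xvar bit_series u * (b w - b w')).
  by exists (y - y'); rewrite !mulrBr ey ey' ecc; ring.
move=> /dvdRE; rewrite xmono_neq0 => /(_ isT).
rewrite vvalM vvalB !bP !val_xmono -tofracB -tofracM.
have x0 m : ps_mono 1 m != 0 :> pseries K by rewrite ps_mono_neq0 ?oner_neq0.
move=> /vint_frac; rewrite x0 => /(_ isT); rewrite lead_mono ?oner_neq0 //.
have d0 := coef_neq0 dk.
move=> /vge_le_lead; rewrite mulf_neq0 // => /(_ isT).
rewrite leadM // lead_mono ?oner_neq0 // => le1.
have le2 : (lead (bit_series w - bit_series w') <= t *+ k)%O.
  by rewrite leNgt; apply/negP => /vge_lead e; rewrite e eqxx in dk.
have := le_trans le1 (mono_leD (lexx (var u)) le2); rewrite leNgt => /negP; apply.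
apply: lt_var => x vx; rewrite monoDE varE coef_varn.
by rewrite !gt_eqF // ?(lt_le_trans _ vx).
Qed.
End EssentiallyUncountable.

Theorem mainTheorem2 (K : fieldType) (hK : countable [set: K]) :
  exists R1 R2 : idomainType,
    valuation_domain R1 /\ valuation_domain R2 /\
    aleph1 [set: R1] /\ aleph1 [set: R2] /\
    residue_field_iso R1 K /\ residue_field_iso R2 K /\
    same_value_group R1 R2 /\
    (exists S1 : set {fraction R1}, aleph1 S1 /\ generates S1) /\
    (forall S1 : set {fraction R1}, countable S1 -> ~ generates S1) /\
    (exists S2 : set {fraction R2}, aleph1 S2 /\ generates S2) /\
    (forall S2 : set {fraction R2}, countable S2 -> ~ generates S2) /\
    essentially_uncountable R1 /\ strongly_countable R2.
Proof.
have gen s : exists S : set {fraction (vring (gens (K := K) s))}, aleph1 S /\ generates S.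
  (* The whole quotient field has cardinality aleph_1 and serves as its own generating set. *)
  exists setT; split; first exact: aleph1_vfrac.
  move=> q; exists 1%N, (fun=> 1), (fun=> q); split=> //.
  by rewrite big_ord1 tofrac1 mul1r.
exists (vring (gens (@bit_series K))), (vring (gens (fun=> 0 : pseries K))).
split; first exact: vring_valuation_domain.
split; first exact: vring_valuation_domain.
split; first exact: aleph1_vring.
split; first exact: aleph1_vring.
split; first exact: vring_residue_field.
split; first exact: vring_residue_field.
split; first exact: vring_same_value_group.
split; first exact: gen.
split; first by move=> S; exact: vfrac_not_countably_generated.
split; first exact: gen.
split; first by move=> S; exact: vfrac_not_countably_generated.
split.
  exists omega1, (fun u w => (u < w)%O), (xvar _).
  split; first exact: xvar_presentation.
  (* The index [v] must exceed both [u] and the index of the variable carrying the series. *)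
  move=> u; have [v vP] := seq_bounded [:: u; omega1_0].
  exists v; split; first by apply: vP; rewrite mem_head.
  by apply: quot_uncountable_xvar; apply: vP; rewrite !inE eqxx ?orbT.
exists omega1, (fun u w => (u < w)%O), (xvar _).
split; first exact: xvar_presentation.
by move=> w; exact: quot_countable_xvar.
Qed.
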